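(* For every $\varepsilon>0$ there exists $\delta>0$ such that the following holds. Let $G$ be a $5$-partite graph on vertex sets $V_1,\dots,V_5$ with $|V_1|=\cdots=|V_5|=n$, such that every edge of $G$ lies between $V_i$ and $V_{i+1}$ for some $i$ (indices taken mod $5$). Suppose that (a) $G$ has at most $\delta n^2$ copies of $C_4$ whose vertices lie in two different parts $V_i$ (i.e. whose vertex set is contained in the union of two of the parts), and (b) $G$ has at most $\delta n^{5/2}$ copies of $C_5$. Then $G$ can be made $C_5$-free by removing at most $\varepsilon n^{3/2}$ edges.
   Context: $C_k$ denotes the cycle on $k$ vertices; a copy of $C_k$ in $G$ is a subgraph isomorphic to $C_k$. *)

(* Defs.v *)
From mathcomp Require Import all_boot.
From Stdlib Require Import Reals.
Set Implicit Arguments. Unset Strict Implicit. Unset Printing Implicit Defensive.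

Definition vtx (n : nat) : finType := ('I_5 * 'I_n)%type.
Definition part {n : nat} (x : vtx n) : 'I_5 := x.1.

Section Graphs.
Local Unset Implicit Arguments.
Variable T : finType.

Definition simple_graph (G : rel T) : Prop :=
  (forall x y, G x y = G y x) /\ (forall x, ~~ G x x).

Definition edges (G : rel T) : {set {set T}} :=
  [set [set x; y] | x in T, y in T & G x y].

Definition cyc_edges (k : nat) (f : 'I_k -> T) : {set {set T}} :=
  [set [set f i; f (ordS i)] | i : 'I_k].

(* Copies of C_k in G (as subgraphs, identified by their edge sets) whose
   vertex map satisfies the extra predicate P. *)
Definition copies_with (G : rel T) (k : nat) (P : pred {ffun 'I_k -> T})
  : {set {set {set T}}} :=
  [set E | [exists f : {ffun 'I_k -> T},
     [&& injectiveb f, P f, [forall i : 'I_k, G (f i) (f (ordS i))]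
       & E == cyc_edges k f]]].

Definition copies (G : rel T) (k : nat) : {set {set {set T}}} :=
  copies_with G k predT.

Definition Ck_free (G : rel T) (k : nat) : Prop := copies G k = set0.

End Graphs.
Arguments edges {T} G.
Arguments simple_graph {T} G.
Arguments cyc_edges {T} k f.
Arguments copies_with {T} G k P.
Arguments copies {T} G k.
Arguments Ck_free {T} G k.

Definition cyclic_5partite (n : nat) (G : rel (vtx n)) : Prop :=
  forall x y, G x y ->
    ((part x).+1 %% 5 == part y) || ((part y).+1 %% 5 == part x).

Definition C4_two_parts (n : nat) (G : rel (vtx n)) : {set {set {set vtx n}}} :=
  copies_with G 4 (fun f => [exists i : 'I_5, exists j : 'I_5,
                       [forall v : 'I_4, (part (f v) == i) || (part (f v) == j)]]).

(* Main.v *)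
Require Import Defs.
From Stdlib Require Import Reals.
From mathcomp Require Import all_boot all_order all_algebra.
From mathcomp Require Import ring lra zify.
From mathcomp Require Import boolp Rstruct.

(* Put s = sqrt n and let g be s times the adjacency matrix of G, so that averages
   of g over large boxes are of order 1 and normalised codegrees are of order 1.

   Since two vertices of the same part rarely have more than a bounded number of
   common neighbours, every step function obtained by averaging g over a partition
   into classes of positive measure has bounded L^2 norm.  The energy increment
   argument therefore works for the sparse kernel g and gives a coarse partition c
   and a refinement c1 such that the two averages W and W1 of g are L^2-close while
   W1 approximates g from below on boxes, with an error that is tiny compared with
   the size of the classes of c.

   Delete the edges of G lying in blocks of c where W is small or where W1 is far
   from W in mean square.  If a 5-cycle survives, W1 is bounded below on most of
   each of the five blocks which it visits, so that the dense count of 5-cycles in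
   these blocks is bounded below.  The counting lemma transfers this lower bound to
   g, contradicting the scarcity of 5-cycles.  It replaces the factors of the count
   one by one, which is possible because degrees are at most a multiple of s (after
   deleting few edges) and because the number of paths of length two, as a kernel,
   is bounded in L^2. *)

Set Implicit Arguments. Unset Strict Implicit. Unset Printing Implicit Defensive.
Import Order.TTheory GRing.Theory Num.Theory.
Local Open Scope ring_scope.

(** * Normalised averages and the weighted Cauchy-Schwarz inequality *)

Definition avg (K : realFieldType) (T : finType) (f : T -> K) : K :=
  #|T|%:R^-1 * \sum_x f x.

Notation "\E_ x F" := (avg (fun x => F))
  (at level 36, x name, F at level 36, format "\E_ x  F").

Section Average.
Variables (K : realFieldType) (T : finType).
Implicit Types (f g : T -> K) (c : K).

Lemma eq_avg f g : f =1 g -> avg f = avg g.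
Proof. by move=> fg; congr (_ * _); apply: eq_bigr => x _. Qed.

Lemma avgD f g : \E_x (f x + g x) = avg f + avg g.
Proof. by rewrite /avg big_split mulrDr. Qed.

Lemma avgN f : \E_x (- f x) = - avg f.
Proof. by rewrite /avg sumrN mulrN. Qed.

Lemma avgB f g : \E_x (f x - g x) = avg f - avg g.
Proof. by rewrite avgD avgN. Qed.

Lemma avgZl c f : \E_x (c * f x) = c * avg f.
Proof. by rewrite /avg -mulr_sumr mulrCA. Qed.

Lemma avgZr c f : \E_x (f x * c) = avg f * c.
Proof. by rewrite /avg -mulr_suml mulrA. Qed.

Lemma avg_ge0 f : (forall x, 0 <= f x) -> 0 <= avg f.
Proof. by move=> f0; rewrite mulr_ge0 ?invr_ge0 ?ler0n ?sumr_ge0. Qed.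

Lemma ler_avg f g : (forall x, f x <= g x) -> avg f <= avg g.
Proof. by move=> fg; rewrite ler_wpM2l ?invr_ge0 ?ler0n ?ler_sum. Qed.

Lemma avg_cst (x : T) c : avg (fun _ : T => c) = c.
Proof.
have T0 : (0 < #|T|)%N by apply/card_gt0P; exists x.
by rewrite /avg sumr_const -[c *+ _]mulr_natl mulKf // pnatr_eq0 -lt0n.
Qed.

(** Over an empty type [avg] takes the value 0, whence the condition [0 <= c]. *)
Lemma avg_le_cst f c : 0 <= c -> (forall x, f x <= c) -> avg f <= c.
Proof.
move=> c0 fc; case: (pickP T) => [x _|T0]; last first.
  by rewrite /avg big1 ?mulr0 // => x; move: (T0 x).
by rewrite -(avg_cst x c) ler_avg.
Qed.

(** The average of [k x * (f x - t) ^+ 2] is a nonnegative quadratic in [t]; its minimum is at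
    [t = a / p]. *)
Lemma avg_jensen k f : (forall x, 0 <= k x) ->
  (\E_x (k x * f x)) ^+ 2 <= avg k * \E_x (k x * f x ^+ 2).
Proof.
move=> k0; set a := avg (fun x => k x * f x); set p := avg k; set q := \E_x (k x * _).
have p0 : 0 <= p by apply: avg_ge0.
have H t : 0 <= q - 2 * t * a + t ^+ 2 * p.
  rewrite -!avgZl -avgB -avgD; apply: avg_ge0 => x.
  have -> : k x * f x ^+ 2 - 2 * t * (k x * f x) + t ^+ 2 * k x = k x * (f x - t) ^+ 2 by ring.
  by rewrite mulr_ge0 ?sqr_ge0.
have [p_eq0|pN0] := eqVneq p 0.
  have q0 : 0 <= q by apply: avg_ge0 => x; rewrite mulr_ge0 ?sqr_ge0.
  have [->|aN0] := eqVneq a 0; first by rewrite expr0n mulr_ge0.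
  (* With zero total weight the quadratic degenerates to [q - 2 * t * a], and this [t] makes it
     negative. *)
  have := H ((q + 1) / a); rewrite p_eq0 mulr0 addr0 -mulrA divfK //.
  lra.
have := H (a / p).
have -> : q - 2 * (a / p) * a + (a / p) ^+ 2 * p = (p * q - a ^+ 2) / p by field.
by rewrite pmulr_lge0 ?subr_ge0 // invr_gt0 lt_neqAle eq_sym pN0.
Qed.

Lemma avg_sqr_le f : (avg f) ^+ 2 <= \E_x (f x ^+ 2).
Proof.
have [x _|T0] := pickP T; last by rewrite /avg !big1 ?mulr0 ?expr0n // => x; move: (T0 x).
have := @avg_jensen (fun=> 1) f (fun=> ler01).
by rewrite avg_cst // mul1r; under eq_avg do rewrite mul1r; under [in leRHS]eq_avg do rewrite mul1r.
Qed.

End Average.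

Lemma sum_sqr_le (K : realFieldType) (n : nat) (f : 'I_n -> K) :
  (\sum_i f i) ^+ 2 <= n%:R * \sum_i f i ^+ 2.
Proof.
have [n0|n0] := posnP n; first by subst n; rewrite !big_ord0 expr0n mulr0.
have n0' : n%:R != 0 :> K by rewrite pnatr_eq0 -lt0n.
have := avg_sqr_le f; rewrite /avg card_ord exprMn exprVn.
rewrite -(ler_pM2l (x := n%:R ^+ 2)) ?exprn_gt0 ?ltr0n // mulrA divff ?expf_neq0 // mul1r.
by rewrite mulrA [_ ^+ 2 / _]mulfK.
Qed.

Lemma avg_exchange (K : realFieldType) (S T : finType) (F : S -> T -> K) :
  \E_x \E_y F x y = \E_y \E_x F x y.
Proof.
rewrite /avg -!mulr_sumr exchange_big /= mulrCA; congr (_ * (_ * _)).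
Qed.

(** * Kernels as integral operators: products, traces, degree bounds *)

Section Kernels.
Variables (K : realFieldType) (T : finType).
Implicit Types (A B C D : T -> T -> K) (u v : T -> K).

(** Composition for the uniform probability measure, so that traces of products are cycle
    densities. *)
Definition kmul A B : T -> T -> K := fun x z => \E_y (A x y * B y z).
Definition ktr A : K := \E_x A x x.

Lemma kmulA A B C : kmul A (kmul B C) = kmul (kmul A B) C.
Proof.
apply/funext => x; apply/funext => z; rewrite /kmul.
under eq_avg do rewrite -avgZl.
rewrite avg_exchange; apply: eq_avg => y; rewrite -avgZr.
by apply: eq_avg => t; rewrite mulrA.
Qed.

Lemma ktr_mulC A B : ktr (kmul A B) = ktr (kmul B A).
Proof.
rewrite /ktr /kmul avg_exchange; apply: eq_avg => x; apply: eq_avg => y.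
by rewrite mulrC.
Qed.

Definition kbound A (c : K) := forall x y, 0 <= A x y <= c.
Definition kle A B := forall x y, A x y <= B x y.
Definition knneg A := forall x y, 0 <= A x y.
Definition rows_le A (d : K) := forall x, \E_y A x y <= d.
Definition cols_le A (d : K) := forall y, \E_x A x y <= d.

Lemma knneg_mul A B : knneg A -> knneg B -> knneg (kmul A B).
Proof. by move=> A0 B0 x y; apply: avg_ge0 => z; rewrite mulr_ge0. Qed.

Lemma kle_mul A A' B B' : knneg A -> knneg B -> kle A A' -> kle B B' ->
  kle (kmul A B) (kmul A' B').
Proof. by move=> A0 B0 AA BB x y; apply: ler_avg => z; rewrite ler_pM. Qed.

Lemma ler_ktr A B : kle A B -> ktr A <= ktr B.
Proof. by move=> AB; apply: ler_avg. Qed.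

Lemma kbound_nneg A c : kbound A c -> knneg A.
Proof. by move=> Ac x y; case/andP: (Ac x y). Qed.

(** A sparse kernel is unbounded but has bounded degrees; composing it with a bounded kernel
    therefore gives a bounded kernel, to which regularity applies. *)
Lemma kmul_boundl A B c d : 0 <= d -> 0 <= c -> kbound A c -> knneg B -> cols_le B d ->
  kbound (kmul A B) (c * d).
Proof.
move=> d0 c0 Ac B0 Bd x y; rewrite knneg_mul //=; last exact: kbound_nneg Ac.
apply: le_trans (_ : \E_z (c * B z y) <= _).
  by apply: ler_avg => z; rewrite ler_wpM2r //; case/andP: (Ac x z).
by rewrite avgZl ler_wpM2l.
Qed.

Lemma kmul_boundr A B c d : 0 <= d -> 0 <= c -> knneg A -> rows_le A d -> kbound B c ->
  kbound (kmul A B) (d * c).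
Proof.
move=> d0 c0 A0 Ad Bc x y; rewrite knneg_mul //=; last exact: kbound_nneg Bc.
apply: le_trans (_ : \E_z (A x z * c) <= _).
  by apply: ler_avg => z; rewrite ler_wpM2l //; case/andP: (Bc z y).
by rewrite avgZr ler_wpM2r.
Qed.

Lemma kbound_cols A c : 0 <= c -> kbound A c -> cols_le A c.
Proof. by move=> c0 Ac y; apply: avg_le_cst => // x; case/andP: (Ac x y). Qed.

Lemma kmul_bound A B c d : 0 <= c -> 0 <= d -> kbound A c -> kbound B d ->
  kbound (kmul A B) (c * d).
Proof.
move=> c0 d0 Ac Bd; apply: kmul_boundl => //; first exact: kbound_nneg Bd.
exact: kbound_cols Bd.
Qed.

Lemma cols_kmul A B c d : 0 <= c -> knneg A -> knneg B -> cols_le A c -> cols_le B d ->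
  cols_le (kmul A B) (c * d).
Proof.
move=> c0 A0 B0 Ac Bd y; rewrite /kmul avg_exchange.
under eq_avg do rewrite avgZr.
apply: le_trans (_ : \E_z (c * B z y) <= _).
  by apply: ler_avg => z; rewrite ler_wpM2r.
by rewrite avgZl ler_wpM2l.
Qed.

Lemma rows_kmul A B c d : 0 <= d -> knneg A -> knneg B -> rows_le A c -> rows_le B d ->
  rows_le (kmul A B) (c * d).
Proof.
move=> d0 A0 B0 Ac Bd x; rewrite /kmul avg_exchange.
under eq_avg do rewrite avgZl.
apply: le_trans (_ : \E_z (A x z * d) <= _).
  by apply: ler_avg => z; rewrite ler_wpM2l.
by rewrite avgZr ler_wpM2r.
Qed.

(** * Bilinear forms, one-sided regularity and truncation *)

Definition weight u := forall x, 0 <= u x <= 1.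

Definition kform u A v : K := \E_x \E_y (u x * A x y * v y).

(* One-sided regularity in cut norm: only lower bounds on [g] are ever needed. *)
Definition minorant (e : K) (g U : T -> T -> K) :=
  forall u v, weight u -> weight v -> kform u U v <= kform u g v + e.

Lemma kform_scale a b u A v :
  kform (fun x => a * u x) A (fun y => b * v y) = a * b * kform u A v.
Proof.
rewrite /kform -avgZl; apply: eq_avg => x; rewrite -avgZl; apply: eq_avg => y.
ring.
Qed.

Lemma minorant_scaled e g U u v a b : 0 < a -> 0 < b ->
  (forall x, 0 <= u x <= a) -> (forall x, 0 <= v x <= b) -> minorant e g U ->
  kform u U v <= kform u g v + a * b * e.
Proof.
move=> a0 b0 ua vb mgU.
have E A : kform u A v = a * b * kform (fun x => u x / a) A (fun y => v y / b).
  rewrite -kform_scale /kform; apply: eq_avg => x; apply: eq_avg => y.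
  by rewrite [a * _]mulrC [b * _]mulrC !divfK ?gt_eqF.
rewrite !E -mulrDr ler_pM2l ?mulr_gt0 //; apply: mgU => x.
  by rewrite ler_pdivrMr // mul1r; move: (ua x) => /andP[? ->]; rewrite divr_ge0 // ltW.
by rewrite ler_pdivrMr // mul1r; move: (vb x) => /andP[? ->]; rewrite divr_ge0 // ltW.
Qed.

(** For fixed [t] the remaining factors are a weight in [x] times a weight in [y]. This exposes the
    factor [A] to cut-norm control. *)
Lemma ktr_kform A P Q : ktr (kmul A (kmul P Q)) = \E_t kform (Q t) A (P^~ t).
Proof.
rewrite /ktr /kmul /kform.
under eq_avg => x.
  under eq_avg => y do rewrite -avgZl.
  over.
under eq_avg => x do rewrite avg_exchange.
rewrite avg_exchange; apply: eq_avg => t; apply: eq_avg => x; apply: eq_avg => y.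
ring.
Qed.

Lemma ktr_minorant e g U P Q a b : 0 <= e -> 0 < a -> 0 < b -> minorant e g U ->
  kbound P a -> kbound Q b ->
  ktr (kmul U (kmul P Q)) <= ktr (kmul g (kmul P Q)) + a * b * e.
Proof.
move=> e0 a0 b0 mgU Pa Qb; rewrite !ktr_kform -lerBlDl -avgB.
apply: avg_le_cst => [|t]; first by rewrite !mulr_ge0 // ltW.
by rewrite lerBlDl [a * b]mulrC; apply: minorant_scaled => // x.
Qed.

Lemma kmulDl A B C : kmul (fun x y => A x y + B x y) C = fun x y => kmul A C x y + kmul B C x y.
Proof.
apply/funext => x; apply/funext => y; rewrite /kmul -avgD.
by apply: eq_avg => z; rewrite mulrDl.
Qed.

Lemma ktrD A B : ktr (fun x y => A x y + B x y) = ktr A + ktr B.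
Proof. exact: avgD. Qed.

Lemma ktr_mul_le A B (c : K) : knneg A -> (forall x y, B x y <= c) ->
  ktr (kmul A B) <= c * \E_x \E_y A x y.
Proof.
move=> A0 Bc; rewrite /ktr /kmul -avgZl; apply: ler_avg => x.
by rewrite -avgZl; apply: ler_avg => y; rewrite mulrC ler_wpM2r.
Qed.

Definition trunc (m : K) A : T -> T -> K := fun x y => Num.min (A x y) m.

Lemma trunc_bound m A : 0 <= m -> knneg A -> kbound (trunc m A) m.
Proof. by move=> m0 A0 x y; rewrite /trunc ge_min lexx orbT le_min A0 m0. Qed.

Lemma trunc_le m A : kle (trunc m A) A.
Proof. by move=> x y; rewrite /trunc ge_min lexx. Qed.

(** The excess of [A] over height [m] is at most [A ^+ 2 / m] pointwise, so an L^2 bound on [A]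
    controls its average. *)
Lemma ktr_trunc (m c C : K) A B : 0 < m -> 0 <= c -> knneg A -> (forall x y, B x y <= c) -> 
  \E_x \E_y (A x y ^+ 2) <= C ->
  ktr (kmul A B) <= ktr (kmul (trunc m A) B) + c * (C / m).
Proof.
move=> m0 c0 A0 Bc AC.
have -> : kmul A B = kmul (fun x y => trunc m A x y + (A x y - trunc m A x y)) B.
  by congr kmul; apply/funext => x; apply/funext => y; rewrite addrCA subrr addr0.
rewrite kmulDl ktrD lerD2l.
apply: (le_trans (ktr_mul_le _ Bc)) => [x y|]; first by rewrite subr_ge0 trunc_le.
rewrite ler_wpM2l // ler_pdivlMr // mulrC -avgZl (le_trans _ AC) //.
apply: ler_avg => x; rewrite -avgZl; apply: ler_avg => y; rewrite /trunc.
have := A0 x y; case: (leP (A x y) m) => Am Axy0; first by rewrite subrr mulr0 sqr_ge0.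
nra.
Qed.

(** * The counting lemma for 5-cycles *)

Definition ktr5 A1 A2 A3 A4 A5 := ktr (kmul A1 (kmul A2 (kmul A3 (kmul A4 A5)))).

Lemma ktr5_rot A1 A2 A3 A4 A5 : ktr5 A1 A2 A3 A4 A5 = ktr5 A2 A3 A4 A5 A1.
Proof. by rewrite /ktr5 ktr_mulC -!kmulA. Qed.

(* The factors are replaced in the order g3, g2, g1, g4, g5.  The first two
   replacements see the two-step kernels g1 g2 and g4 g5, which are only bounded
   in L^2, and therefore truncate them at height m. *)
Lemma counting_lemma g1 g2 g3 g4 g5 U1 U2 U3 U4 U5 (e d m C : K) :
  0 <= e -> 0 < d -> 0 < m ->
  [/\ knneg g1, knneg g2, knneg g3, knneg g4 & knneg g5] ->
  [/\ cols_le g1 d, cols_le g2 d, cols_le g4 d & cols_le g5 d] ->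
  rows_le g1 d -> rows_le g5 d ->
  [/\ kbound U1 1, kbound U2 1, kbound U3 1, kbound U4 1 & kbound U5 1] ->
  [/\ minorant e g1 U1, minorant e g2 U2, minorant e g3 U3, minorant e g4 U4
    & minorant e g5 U5] ->
  \E_x \E_y (kmul g1 g2 x y ^+ 2) <= C -> \E_x \E_y (kmul g4 g5 x y ^+ 2) <= C ->
  ktr5 U1 U2 U3 U4 U5 <= ktr5 g1 g2 g3 g4 g5
    + (m ^+ 2 + d * m + d ^+ 2 + d + 1) * e + (d ^+ 2 + d) * C / m.
Proof.
move=> e0 d0 m0 [p1 p2 p3 p4 p5] [c1 c2 c4 c5] r1 r5 [b1 b2 b3 b4 b5] [n1 n2 n3 n4 n5] C12 C45.
have [q1 q2 q3 q4 q5] : [/\ knneg U1, knneg U2, knneg U3, knneg U4 & knneg U5].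
  by split; [move: b1|move: b2|move: b3|move: b4|move: b5]; apply: kbound_nneg.
have dge0 := ltW d0; have mge0 := ltW m0.
have [P EP] : exists P, P = kmul g1 g2 by eexists.
have [Q EQ] : exists Q, Q = kmul g4 g5 by eexists.
move: C12 C45; rewrite -EP -EQ => C12 C45.
have P0 : knneg P by rewrite EP; apply: knneg_mul.
have Q0 : knneg Q by rewrite EQ; apply: knneg_mul.
have Pm := trunc_bound mge0 P0; have Qm := trunc_bound mge0 Q0.
have Pm0 := kbound_nneg Pm; have Qm0 := kbound_nneg Qm.
(* All kernels are nonnegative, so truncating both two-step kernels only lowers the trace. *)
have s1 : ktr (kmul g3 (kmul (trunc m Q) (trunc m P))) <= ktr5 g1 g2 g3 g4 g5.
  rewrite ktr5_rot ktr5_rot /ktr5 (kmulA g4) -EP -EQ.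
  apply: ler_ktr; apply: kle_mul => //; first exact: knneg_mul.
  by apply: kle_mul => //; apply: trunc_le.
have s2 := ktr_minorant e0 m0 m0 n3 Qm Pm.
(* The truncation of [P] is undone before [g2] is replaced: its cofactor is at most [d ^+ 2],
   because the columns of [Q] average at most [d * d] and [U3] is bounded by 1. *)
have s3 : ktr (kmul U3 (kmul (trunc m Q) P)) <=
    ktr (kmul U3 (kmul (trunc m Q) (trunc m P))) + d ^+ 2 * (C / m).
  rewrite !kmulA ktr_mulC [X in X + _]ktr_mulC; apply: ktr_trunc => //; first exact: sqr_ge0.
  move=> x y; have : cols_le Q (d * d) by rewrite EQ; apply: cols_kmul.
  move/(_ y); rewrite -expr2; apply: le_trans; apply: ler_avg => z.
  have := b3 x z; have := Qm0 z y; have := trunc_le m Q z y; nra.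
have s4 : ktr (kmul U2 (kmul U3 (kmul (trunc m Q) g1))) <=
          ktr (kmul U3 (kmul (trunc m Q) P)) + 1 * (m * d) * e.
  have -> : ktr (kmul U3 (kmul (trunc m Q) P)) = ktr (kmul g2 (kmul U3 (kmul (trunc m Q) g1))).
    by rewrite EP [RHS]ktr_mulC -!kmulA.
  apply: ktr_minorant; rewrite ?mulr_gt0 //; exact: kmul_boundl.
(* Likewise for [Q]; its cofactor is at most [d] by the row bound on [g1]. *)
have s5 : ktr (kmul Q (kmul g1 (kmul U2 U3))) <=
          ktr (kmul U2 (kmul U3 (kmul (trunc m Q) g1))) + d * (C / m).
  have -> : ktr (kmul U2 (kmul U3 (kmul (trunc m Q) g1))) =
            ktr (kmul (trunc m Q) (kmul g1 (kmul U2 U3))).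
    by rewrite kmulA ktr_mulC -!kmulA.
  apply: ktr_trunc => // x y.
  have : kbound (kmul g1 (kmul U2 U3)) (d * (1 * 1)).
    by apply: kmul_boundr; rewrite ?mulr1 ?ler01 //; rewrite -[1]mulr1; apply: kmul_bound; rewrite ?ler01.
  by move/(_ x y)/andP => [_]; rewrite !mulr1.
have s6 : ktr (kmul U1 (kmul U2 (kmul U3 Q))) <=
          ktr (kmul Q (kmul g1 (kmul U2 U3))) + 1 * (1 * (d * d)) * e.
  have -> : ktr (kmul Q (kmul g1 (kmul U2 U3))) = ktr (kmul g1 (kmul U2 (kmul U3 Q))).
    by rewrite ktr_mulC -!kmulA.
  apply: ktr_minorant; rewrite ?mul1r ?mulr_gt0 // -[d * d]mul1r.
  apply: kmul_boundl; rewrite ?mulr_ge0 ?ler01 // EQ; exact: cols_kmul.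
have s7 : ktr (kmul U4 (kmul (kmul g5 U1) (kmul U2 U3))) <=
          ktr (kmul U1 (kmul U2 (kmul U3 Q))) + (d * 1) * (1 * 1) * e.
  have -> : ktr (kmul U1 (kmul U2 (kmul U3 Q))) = ktr (kmul g4 (kmul (kmul g5 U1) (kmul U2 U3))).
    by rewrite EQ !kmulA ktr_mulC !kmulA ktr_mulC !kmulA.
  apply: ktr_minorant; rewrite ?mulr1 //; first by rewrite -[d]mulr1; apply: kmul_boundr; rewrite ?ler01.
  by rewrite -[1]mulr1; apply: kmul_bound; rewrite ?ler01.
have s8 : ktr5 U1 U2 U3 U4 U5 <=
    ktr (kmul U4 (kmul (kmul g5 U1) (kmul U2 U3))) + 1 * 1 * e.
  have -> : ktr (kmul U4 (kmul (kmul g5 U1) (kmul U2 U3))) = ktr (kmul g5 (kmul (kmul U1 U2) (kmul U3 U4))).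
    by rewrite ktr_mulC -!kmulA.
  have -> : ktr5 U1 U2 U3 U4 U5 = ktr (kmul U5 (kmul (kmul U1 U2) (kmul U3 U4))).
    by rewrite /ktr5 [RHS]ktr_mulC -!kmulA.
  by apply: ktr_minorant => //; rewrite -[X in kbound _ X]mulr1; apply: kmul_bound; rewrite ?ler01.
move: s1 s2 s3 s4 s5 s6 s7 s8; set a1 := ktr (kmul g3 _); set a2 := ktr (kmul U3 (kmul _ (trunc m P))).
rewrite (_ : (d ^+ 2 + d) * C / m = d ^+ 2 * (C / m) + d * (C / m)); last by rewrite -mulrDl mulrA.
lra.
Qed.

End Kernels.

(** * Conditional expectation onto the blocks of a partition *)

Section ConditionalExpectation.
Variables (K : realFieldType) (T : finType).
Implicit Types (c : T -> nat) (g F : T -> T -> K) (u v : T -> K).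

Definition blockm c (x : T) : K := \E_y (c x == c y)%:R.
(** Partitions are encoded as colourings by naturals. This is the kernel of the orthogonal
    projection onto functions constant on colour classes. *)
Definition cker c : T -> T -> K := fun x y => (c x == c y)%:R / blockm c x.
Definition cexp c g := kmul (cker c) (kmul g (cker c)).
Definition refines c1 c := forall x y, c1 x = c1 y -> c x = c y.
Definition minblock (k : K) c := forall x, k <= blockm c x.
Definition ksq g : K := \E_x \E_y (g x y ^+ 2).
Definition kip g F : K := \E_x \E_y (g x y * F x y).
Definition invl c F := forall x y z, c x = c y -> F x z = F y z.
Definition invr c F := forall x y z, c x = c y -> F z x = F z y.

Lemma blockm_gt0 c x : 0 < blockm c x.
Proof.
have T0 : (0 < #|T|)%N by apply/card_gt0P; exists x.
rewrite /blockm /avg mulr_gt0 ?invr_gt0 ?ltr0n // (bigD1 x) //= eqxx ltr_pwDl //.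
by apply: sumr_ge0 => y _; rewrite ler0n.
Qed.

Lemma eq_blockm c x y : c x = c y -> blockm c x = blockm c y.
Proof. by move=> cxy; apply: eq_avg => z; rewrite cxy. Qed.

Lemma ckerC c x y : cker c x y = cker c y x.
Proof.
rewrite /cker eq_sym; case: (c y =P c x) => [cyx|]; last by rewrite !mul0r.
by rewrite (eq_blockm cyx).
Qed.

Lemma cker_ge0 c : knneg (cker c).
Proof. by move=> x y; rewrite divr_ge0 ?ler0n ?ltW ?blockm_gt0. Qed.

Lemma cker_row c x : \E_y cker c x y = 1.
Proof. by rewrite avgZr divff // gt_eqF ?blockm_gt0. Qed.

Lemma cker_col c y : \E_x cker c x y = 1.
Proof. by under eq_avg do rewrite ckerC; exact: cker_row. Qed.

Lemma cker_mull c F : invl c F -> kmul (cker c) F = F.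
Proof.
move=> cF; apply/funext => x; apply/funext => z; rewrite /kmul.
rewrite -[RHS]mul1r -(cker_row c x) -avgZr; apply: eq_avg => y.
rewrite /cker; case: (c x =P c y) => [cxy|]; last by rewrite !mul0r.
by rewrite (cF x y).
Qed.

Lemma cker_mulr c F : invr c F -> kmul F (cker c) = F.
Proof.
move=> cF; apply/funext => x; apply/funext => z; rewrite /kmul.
rewrite -[RHS]mulr1 -(cker_col c z) -avgZl; apply: eq_avg => y.
rewrite /cker; case: (c y =P c z) => [cxy|]; last by rewrite !(mul0r, mulr0).
by rewrite (cF y z).
Qed.

Lemma invl_cker c1 c : refines c1 c -> invl c1 (cker c).
Proof. by move=> r x y z /r cxy; rewrite /cker cxy (eq_blockm cxy). Qed.

Lemma invr_cker c1 c : refines c1 c -> invr c1 (cker c).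
Proof. by move=> r x y z cxy; rewrite !(ckerC _ z) (invl_cker r _ cxy). Qed.

Lemma refines_trans c2 c1 c : refines c2 c1 -> refines c1 c -> refines c2 c.
Proof. by move=> r2 r1 x y /r2 /r1. Qed.

Lemma invl_kmul c F g : invl c F -> invl c (kmul F g).
Proof. by move=> cF x y z cxy; apply: eq_avg => t; rewrite (cF x y). Qed.

Lemma invr_kmul c F g : invr c F -> invr c (kmul g F).
Proof. by move=> cF x y z cxy; apply: eq_avg => t; rewrite (cF x y). Qed.

Lemma invl_cexp c1 c g : refines c1 c -> invl c1 (cexp c g).
Proof. by move=> r; apply/invl_kmul/invl_cker. Qed.

Lemma invr_cexp c1 c g : refines c1 c -> invr c1 (cexp c g).
Proof. by move=> r; rewrite /cexp; do 2!apply: invr_kmul; apply: invr_cker. Qed.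

(** The projection is self-adjoint and fixes [F]; written as a trace, this is cyclicity together
    with [cker_mull] and [cker_mulr]. *)
Lemma kip_cexp c g F : invl c F -> invr c F -> kip F (cexp c g) = kip F g.
Proof.
move=> Fl Fr.
have E A : kip F A = ktr (kmul A (fun x y => F y x)).
  by apply: eq_avg => x; apply: eq_avg => y; rewrite mulrC.
rewrite !E /cexp -!kmulA ktr_mulC -!kmulA cker_mulr; last by move=> x y z; apply: Fl.
by rewrite cker_mull // => x y z; apply: Fr.
Qed.

Lemma ksqE g : ksq g = kip g g.
Proof. by apply: eq_avg => x; apply: eq_avg => y; rewrite expr2. Qed.

Lemma ksq_ge0 g : 0 <= ksq g.
Proof. by apply: avg_ge0 => x; apply: avg_ge0 => y; apply: sqr_ge0. Qed.

Lemma ksqB g F : ksq (fun x y => g x y - F x y) = ksq g - 2 * kip F g + ksq F.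
Proof.
rewrite /ksq /kip -avgZl -avgB -avgD; apply: eq_avg => x.
rewrite -avgZl -avgB -avgD; apply: eq_avg => y; ring.
Qed.

(** The coarse step function is constant on blocks of both partitions, so its inner products with
    [cexp c1 g], with [g] and with itself agree. *)
Lemma cexp_pythagoras c1 c g : refines c1 c ->
  ksq (cexp c1 g) = ksq (cexp c g) + ksq (fun x y => cexp c1 g x y - cexp c g x y).
Proof.
move=> r; rewrite ksqB.
rewrite kip_cexp; [|exact: invl_cexp|exact: invr_cexp].
rewrite -(@kip_cexp c); [|exact: invl_cexp|exact: invr_cexp].
rewrite -ksqE; ring.
Qed.

Lemma cexp_sym c g : (forall x y, g x y = g y x) -> forall x y, cexp c g x y = cexp c g y x.
Proof.
move=> gC x y; rewrite /cexp {1}kmulA /kmul; apply: eq_avg => z.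
rewrite (ckerC c z) mulrC; congr (_ * _); apply: eq_avg => t.
by rewrite mulrC gC ckerC.
Qed.

Lemma cexp_ge0 c g : knneg g -> knneg (cexp c g).
Proof. by move=> g0; do 2?apply: knneg_mul => //; exact: cker_ge0. Qed.

Lemma cexp_rows c g (d : K) : 0 <= d -> knneg g -> rows_le g d -> rows_le (cexp c g) d.
Proof.
move=> d0 g0 gd; rewrite -[d]mulr1 -[_ * 1]mul1r.
have k1 : rows_le (cker c) 1 by move=> x; rewrite cker_row.
apply: rows_kmul => //; rewrite ?mulr1 //; try exact: cker_ge0.
  by apply: knneg_mul => //; apply: cker_ge0.
by rewrite -[d]mulr1; apply: rows_kmul => //; apply: cker_ge0.
Qed.

Lemma cexp_block c F x1 y1 :
  \E_x \E_y ((c x1 == c x)%:R * (c y1 == c y)%:R * F x y) =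
  blockm c x1 * blockm c y1 * cexp c F x1 y1.
Proof.
rewrite /cexp /kmul -avgZl; apply: eq_avg => x; set X := avg (fun y => F x y * _).
have -> : blockm c x1 * blockm c y1 * (cker c x1 x * X) =
    (c x1 == c x)%:R * (blockm c y1 * X).
  by rewrite /cker; field; rewrite gt_eqF ?blockm_gt0.
rewrite -!avgZl; apply: eq_avg => y; rewrite ckerC /cker.
by field; rewrite gt_eqF ?blockm_gt0.
Qed.

End ConditionalExpectation.

(** * Sparse kernels and the bound on their energy *)

Section KernelClass.
Variables (K : realFieldType) (T : finType) (part : T -> nat).
Implicit Types (c : T -> nat) (g : T -> T -> K).

Definition codeg g (x y : T) : K := \E_z (g x z * g y z).

(* The last field is the form in which the scarcity of 4-cycles is used: it bounds
   the energy of all step functions whose steps are not too small. *)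
Record sparse_kernel g (d b : K) : Prop := SparseKernel {
  sk_sym : forall x y, g x y = g y x;
  sk_ge0 : knneg g;
  sk_row : rows_le g d;
  sk_codeg : \E_x \E_y ((part x == part y)%:R * Num.max 0 (codeg g x y - 2)) <= b
}.

Lemma sparse_kernelW g (d b b' : K) : b <= b' -> sparse_kernel g d b -> sparse_kernel g d b'.
Proof. by move=> bb [? ? ? H]; split=> //; apply: le_trans bb. Qed.

(** Jensen removes the averaging in the second variable. The square of the one-sided average is then
    an average of codegrees over pairs in the class of [x]. Such pairs lie in one part, so the
    codegrees are 2 plus an excess, which enters with density at most [k ^- 2]. *)
Lemma cexp_energy g d b c (k : K) : sparse_kernel g d b -> 0 < k -> refines c part ->
  minblock k c -> ksq (cexp c g) <= 2 + b / k ^+ 2.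
Proof.
move=> [gC g0 _ gb] k0 rc ck.
have b0 : 0 <= b.
  apply: le_trans gb; apply: avg_ge0 => x; apply: avg_ge0 => y.
  by rewrite mulr_ge0 ?ler0n // le_max lexx.
have bk0 : 0 <= b / k ^+ 2 by rewrite divr_ge0 ?sqr_ge0.
apply: avg_le_cst => [|x]; first by rewrite addr_ge0.
apply: le_trans (_ : \E_y (kmul (cker K c) g x y ^+ 2) <= _).
  rewrite /cexp kmulA.
  apply: le_trans (_ : \E_y \E_z (cker K c y z * kmul (cker K c) g x z ^+ 2) <= _).
    apply: ler_avg => y; rewrite -[leRHS]mul1r -(cker_row K c y).
    apply: le_trans (avg_jensen _ _) => [|z]; last exact: cker_ge0.
    by rewrite /kmul; under eq_avg do rewrite mulrC ckerC.
  rewrite avg_exchange; apply: ler_avg => z.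
  by rewrite avgZr cker_col mul1r.
have -> : \E_y (kmul (cker K c) g x y ^+ 2) =
    \E_s \E_t (cker K c x s * cker K c x t * codeg g s t).
  rewrite /kmul; under eq_avg => y.
    rewrite expr2 -avgZr.
    under eq_avg do rewrite -avgZl.
    over.
  rewrite avg_exchange; apply: eq_avg => s; rewrite avg_exchange; apply: eq_avg => t.
  rewrite /codeg -avgZl; apply: eq_avg => y; ring.
have -> : 2 + b / k ^+ 2 = \E_s \E_t (cker K c x s * cker K c x t * 2) + b / k ^+ 2.
  congr (_ + _); under eq_avg do rewrite avgZr avgZl cker_row mulr1.
  by rewrite avgZr cker_row mul1r.
rewrite -lerBlDl -avgB.
apply: le_trans (_ : \E_s \E_t ((part s == part t)%:R * Num.max 0 (codeg g s t - 2)) / k ^+ 2 <= _); last first.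
  by rewrite ler_wpM2r // invr_ge0 sqr_ge0.
rewrite -avgZr; apply: ler_avg => s; rewrite -avgB -avgZr; apply: ler_avg => t.
rewrite -mulrBr /cker.
set mx := Num.max 0 _; have mx0 : 0 <= mx by rewrite le_max lexx.
have mxle : codeg g s t - 2 <= mx by rewrite le_max lexx orbT.
case: (c x =P c s) => [xs|_]; last first.
  by rewrite !mul0r !mulr_ge0 ?ler0n // invr_ge0 sqr_ge0.
case: (c x =P c t) => [xt|_]; last first.
  by rewrite !(mul0r, mulr0) !mulr_ge0 ?ler0n // invr_ge0 sqr_ge0.
rewrite (rc s t) ?eqxx -?xs // !mul1r.
apply: le_trans (ler_wpM2l _ mxle) _; first by rewrite mulr_ge0 // invr_ge0 ltW ?blockm_gt0.
rewrite mulrC ler_wpM2l // -invfM -expr2 lef_pV2 ?posrE ?exprn_gt0 ?blockm_gt0 //.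
by rewrite ler_pXn2r // nnegrE ltW ?blockm_gt0.
Qed.

End KernelClass.

(** * The energy increment *)

Section Refinement.
Variables (K : realFieldType) (T : finType).
Implicit Types (c : T -> nat) (g : T -> T -> K) (a b : pred T).

(* A linear form on [0,1]-valued functions is maximal at an indicator function. *)
Lemma kform_pred_left (u v : T -> K) (h : T -> T -> K) : weight u ->
  exists a : pred T, kform u h v <= kform (fun x => (a x)%:R) h v.
Proof.
move=> u01; exists (fun x => 0 <= \E_y (h x y * v y)); rewrite /kform; apply: ler_avg => x.
under eq_avg do rewrite -mulrA; under [leRHS]eq_avg do rewrite -mulrA.
rewrite !avgZl; set f := avg _; have /andP[u0 u1] := u01 x.
case: (leP 0 f) => f0 /=; first by rewrite ler_wpM2r.
by rewrite mul0r mulr_ge0_le0 // ltW.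
Qed.

Lemma kformC u v (h : T -> T -> K) : kform u h v = kform v (fun x y => h y x) u.
Proof.
rewrite /kform avg_exchange; apply: eq_avg => x; apply: eq_avg => y; ring.
Qed.

Lemma kform_pred (u v : T -> K) (h : T -> T -> K) : weight u -> weight v ->
  exists a b : pred T, kform u h v <= kform (fun x => (a x)%:R) h (fun y => (b y)%:R).
Proof.
move=> u01 v01; have [a ha] := kform_pred_left v h u01; exists a.
have [b hb] := kform_pred_left (fun x => (a x)%:R) (fun x y => h y x) v01; exists b.
by apply: le_trans ha _; rewrite kformC [leRHS]kformC.
Qed.

(* A class meeting [a] or its complement in measure below [r * k] is not cut, and
   [a] is modified there; this keeps every class of measure at least [r * k]. *)
Lemma split_coloring c (k r : K) a : 0 < k -> 0 < r <= 1 -> minblock k c ->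
  exists c1 (a1 : pred T),
    [/\ refines c1 c, minblock (r * k) c1, forall x y, c1 x = c1 y -> a1 x = a1 y
      & \E_x `|(a x)%:R - (a1 x)%:R| <= r :> K].
Proof.
move=> k0 /andP[r0 r1] ck.
pose p x : K := \E_y ((c x == c y) && a y)%:R.
pose q x : K := \E_y ((c x == c y) && ~~ a y)%:R.
have pE x y : c x = c y -> p x = p y by move=> cxy; apply: eq_avg => z; rewrite cxy.
have qE x y : c x = c y -> q x = q y by move=> cxy; apply: eq_avg => z; rewrite cxy.
pose a1 x := if p x < r * k then false else if q x < r * k then true else a x.
have rk0 : 0 < r * k by rewrite mulr_gt0.
(* The colour [2 * c x + a1 x] encodes the pair of [c x] and the bit [a1 x]. *)
exists (fun x => (2 * c x + a1 x)%N), a1.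
have splitE x y : (2 * c x + a1 x)%N = (2 * c y + a1 y)%N -> c x = c y /\ a1 x = a1 y.
  by case: (a1 x) (a1 y) => [] []; lia.
have whole x : (forall y, c x = c y -> a1 x = a1 y) ->
    r * k <= blockm K (fun x => (2 * c x + a1 x)%N) x.
  move=> H; apply: le_trans (_ : k <= _); first by rewrite ler_piMl // ltW.
  apply: le_trans (ck x) _; apply: ler_avg => y; case: eqP => [cxy|_]; last by rewrite ler0n.
  by rewrite -(H _ cxy) cxy eqxx.
split.
- by move=> x y /splitE[].
- move=> x; case: (ltP (p x) (r * k)) => [px|px].
    by apply: whole => y cxy; rewrite /a1 -(pE _ _ cxy) px.
  case: (ltP (q x) (r * k)) => [qx|qx].
    by apply: whole => y cxy; rewrite /a1 -(pE _ _ cxy) -(qE _ _ cxy) qx.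
  have a1E y : c x = c y -> a1 y = a y.
    by move=> cxy; rewrite /a1 -(pE _ _ cxy) -(qE _ _ cxy) !ltNge px qx.
  case ax: (a x).
    apply: le_trans px _; apply: ler_avg => y.
    case: eqP => [cxy|]; last by rewrite ler0n.
    by rewrite (a1E x) // (a1E y) // ax cxy; case: (a y); rewrite ?eqxx ?ler0n.
  apply: le_trans qx _; apply: ler_avg => y.
  case: eqP => [cxy|]; last by rewrite ler0n.
  by rewrite (a1E x) // (a1E y) // ax cxy; case: (a y); rewrite ?eqxx ?ler0n.
- by move=> x y /splitE[].
pose e x : K := `|(a x)%:R - (a1 x)%:R|.
have e0 x : 0 <= e x by apply: normr_ge0.
(* Averaging over classes first reduces the claim to one class, of measure at least [k], where [a]
   and [a1] differ in measure at most [r * k]. *)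
have -> : avg e = \E_x \E_y (cker K c x y * e y).
  by rewrite avg_exchange; apply: eq_avg => y; rewrite avgZr cker_col mul1r.
apply: avg_le_cst => [|x]; first exact: ltW.
rewrite /cker; under eq_avg do rewrite mulrAC.
rewrite avgZr ler_pdivrMr ?blockm_gt0 //.
apply: le_trans (_ : r * k <= _); last by rewrite ler_pM2l.
case: (ltP (p x) (r * k)) => [px|px].
  apply: le_trans (ltW px); apply: ler_avg => y; case: eqP => [cxy|]; last by rewrite mul0r.
  by rewrite /e /a1 -(pE _ _ cxy) px subr0 normr_nat mul1r.
case: (ltP (q x) (r * k)) => [qx|qx].
  apply: le_trans (ltW qx); apply: ler_avg => y; case: eqP => [cxy|]; last by rewrite mul0r.
  rewrite /e /a1 -(pE _ _ cxy) -(qE _ _ cxy) qx ltNge px /= mul1r.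
  by case: (a y); rewrite ?subrr ?normr0 ?sub0r ?normrN ?normr1.
apply: avg_le_cst => [|y]; first exact: ltW.
case: eqP => [cxy|]; last by rewrite mul0r ltW.
by rewrite /e /a1 -(pE _ _ cxy) -(qE _ _ cxy) !ltNge px qx /= subrr normr0 mulr0 ltW.
Qed.

Lemma kform_pred_close (a a1 : pred T) (v : T -> K) (h : T -> T -> K) (r d : K) :
  0 <= d -> weight v -> (forall x, \E_y `|h x y| <= d) -> \E_x `|(a x)%:R - (a1 x)%:R| <= r :> K ->
  kform (fun x => (a x)%:R) h v <= kform (fun x => (a1 x)%:R) h v + r * d.
Proof.
move=> d0 v01 hd ar; rewrite -lerBlDl /kform -avgB.
apply: le_trans (_ : \E_x (`|(a x)%:R - (a1 x)%:R| * d) <= _); last first.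
  by rewrite avgZr ler_wpM2r.
apply: ler_avg => x; rewrite -avgB.
apply: le_trans (_ : \E_y (`|(a x)%:R - (a1 x)%:R| * `|h x y|) <= _); last first.
  by rewrite avgZl ler_wpM2l.
apply: ler_avg => y; rewrite -mulrBl -mulrBl; have /andP[v0 v1] := v01 y.
apply: le_trans (ler_norm _) _; rewrite 2!normrM (ger0_norm v0) ler_piMr //.
by rewrite mulr_ge0.
Qed.

Lemma weight_pred a : weight (fun x => (a x)%:R : K).
Proof. by move=> x; rewrite ler0n lern1; case: (a x). Qed.

(** A violation of regularity is witnessed by two sets. Splitting the classes along them, up to
    small modifications, yields a box on which the refined step function differs from the coarse
    one; Cauchy-Schwarz and Pythagoras turn this into an energy gain. *)
Lemma energy_increment g (d k e : K) c : (forall x y, g x y = g y x) -> knneg g ->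
  0 < k -> 0 < e -> 0 < d -> e <= 8 * d -> rows_le g d -> minblock k c ->
  ~ minorant e g (cexp c g) ->
  exists c1, [/\ refines c1 c, minblock ((e / (8 * d)) ^+ 2 * k) c1
               & ksq (cexp c g) + e ^+ 2 / 4 <= ksq (cexp c1 g)].
Proof.
move=> gC g0 k0 e0 d0 ed gd ck irr.
have [u [v [u01 v01 uv]]] : exists u v, [/\ weight u, weight v &
    kform u g v + e < kform u (cexp c g) v].
  apply: contrapT => H; apply: irr => u v u01 v01; rewrite leNgt; apply/negP => uv.
  by apply: H; exists u, v.
pose h x y := cexp c g x y - g x y.
have kformB w z A B : kform w (fun x y => A x y - B x y) z = kform w A z - kform w B z.
  rewrite /kform -avgB; apply: eq_avg => x; rewrite -avgB; apply: eq_avg => y; ring.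
have [a [b hab]] := kform_pred h u01 v01.
(* Rows of [h] have L^1 norm at most [2 * d], so each modified set costs [r * (2 * d) = e / 4] and
   half of the discrepancy [e] survives. *)
set r := e / (8 * d).
have r01 : 0 < r <= 1.
  by rewrite divr_gt0 ?mulr_gt0 // ler_pdivrMr ?mulr_gt0 // mul1r.
have [c1 [a1 [rc1 mc1 ca1 aa1]]] := split_coloring a k0 r01 ck.
have rk0 : 0 < r * k by case/andP: r01 => r0 _; rewrite mulr_gt0.
have [c2 [b1 [rc2 mc2 cb1 bb1]]] := split_coloring b rk0 r01 mc1.
have rc : refines c2 c by apply: refines_trans rc1.
exists c2; split=> //; first by move=> x; rewrite expr2 -mulrA.
have hrow x : \E_y `|h x y| <= 2 * d.
  apply: le_trans (_ : \E_y (cexp c g x y + g x y) <= _).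
    apply: ler_avg => y; have := g0 x y; have := cexp_ge0 c g0 x y.
    by rewrite /h ler_norml => ? ?; apply/andP; split; lra.
  by rewrite avgD; have := gd x; have := cexp_rows c (ltW d0) g0 gd x; lra.
have hC x y : h x y = h y x by rewrite /h cexp_sym // gC.
have d20 : 0 <= 2 * d by rewrite mulr_ge0 // ltW.
have s1 := kform_pred_close d20 (weight_pred b) hrow aa1.
have s2 : kform (fun x => (a1 x)%:R) h (fun x => (b x)%:R) <=
          kform (fun x => (a1 x)%:R) h (fun x => (b1 x)%:R) + r * (2 * d).
  rewrite kformC [X in X + _]kformC.
  by apply: kform_pred_close => //; [exact: weight_pred | move=> x; under eq_avg do rewrite hC].
have rd : r * (2 * d) = e / 4 by rewrite /r; field; rewrite gt_eqF.
pose f x y : K := (a1 x)%:R * (b1 y)%:R.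
have ca2 x y : c2 x = c2 y -> a1 x = a1 y by move/rc2/ca1.
have fE A : kform (fun x => (a1 x)%:R) A (fun x => (b1 x)%:R) = kip f A.
  by apply: eq_avg => x; apply: eq_avg => y; rewrite mulrAC.
have fg : kip f (cexp c2 g) = kip f g.
  by apply: kip_cexp => x y z cxy; rewrite /f ?(ca2 _ _ cxy) ?(cb1 _ _ cxy).
(* The box [f] is constant on blocks of [c2], so against it [g] may be replaced by [cexp c2 g]. *)
have key : e / 2 <= kip f (fun x y => cexp c g x y - cexp c2 g x y).
  rewrite -fE kformB !fE fg -!fE -kformB.
  rewrite -[X in kform _ X _]/h; have := hab; rewrite [X in X <= _]kformB; lra.
have CS : (kip f (fun x y => cexp c g x y - cexp c2 g x y)) ^+ 2 <=
   ksq (fun x y => cexp c2 g x y - cexp c g x y).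
  rewrite /kip.
  apply: le_trans (avg_sqr_le _) _; apply: ler_avg => x.
  apply: le_trans (avg_sqr_le _) _; apply: ler_avg => y.
  rewrite exprMn -[(cexp c2 g x y - _) ^+ 2]sqrrN opprB ler_piMl ?sqr_ge0 // /f -natrM expr_le1 ?ler0n //.
  by rewrite lern1; case: (a1 x); case: (b1 y).
rewrite (cexp_pythagoras g rc) lerD2l; apply: le_trans CS.
have -> : e ^+ 2 / 4 = (e / 2) ^+ 2 by field.
by rewrite ler_pXn2r ?nnegrE // ?(le_trans _ key) // ltW ?divr_gt0.
Qed.

End Refinement.

(** * Weak and strong regularity by iteration *)

Lemma archi_multiple (K : archiRealFieldType) (t B : K) : 0 < t -> exists m : nat, B <= m%:R * t.
Proof.
move=> t0; exists (Num.bound `|B / t|).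
rewrite -ler_pdivrMr //; apply: le_trans (ler_norm _) _.
by rewrite ltW // archi_boundP.
Qed.

Section Regularity.
Variable K : archiRealFieldType.
Variable d : K.
Hypothesis d0 : 0 < d.

(** The 4-cycle excess [k ^+ 2 / 2] gives energy at most 2 + 1/2; 3 serves as the ceiling
    throughout. *)
Lemma energy_lt3 (T : finType) part g (c : T -> nat) (k : K) : 0 < k ->
  sparse_kernel part g d (k ^+ 2 / 2) -> refines c part -> minblock k c -> ksq (cexp c g) < 3.
Proof.
move=> k0 gk rc ck; apply: le_lt_trans (cexp_energy gk k0 rc ck) _.
have -> : k ^+ 2 / 2 / k ^+ 2 = 1 / 2 by field; rewrite gt_eqF.
lra.
Qed.

(** Induction on the number [m] of increments left below the ceiling 3; for [m = 0] the energy would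
    already reach it. The constants are fixed along the induction, before the kernel is given. *)
Lemma weak_regularity_step (e : K) (m : nat) : 0 < e -> e <= 8 * d ->
  forall k : K, 0 < k -> exists k1 b : K, [/\ 0 < k1, 0 < b &
    forall (T : finType) (part : T -> nat) (g : T -> T -> K) (c : T -> nat),
      sparse_kernel part g d b -> refines c part -> minblock k c ->
      3 - m%:R * (e ^+ 2 / 4) <= ksq (cexp c g) ->
      exists c1, [/\ refines c1 c, minblock k1 c1 & minorant e g (cexp c1 g)]].
Proof.
move=> e0 ed; elim: m => [|m IHm] k k0.
  exists k, (k ^+ 2 / 2); split=> //; first by rewrite divr_gt0 ?exprn_gt0.
  move=> T part g c gk rc ck; rewrite mul0r subr0.
  by rewrite leNgt (energy_lt3 k0 gk rc ck).
have k20 : 0 < (e / (8 * d)) ^+ 2 * k by rewrite mulr_gt0 ?exprn_gt0 ?divr_gt0 ?mulr_gt0.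
have [k1 [b [k10 b0 H]]] := IHm _ k20.
exists (Num.min k1 k), b; split=> //; first by rewrite lt_min k10.
move=> T part g c gk rc ck; rewrite -natr1 => en.
have [reg|irr] := pselect (minorant e g (cexp c g)).
  by exists c; split=> // x; rewrite ge_min ck orbT.
have [gC g0 gd _] := gk.
have [c2 [rc2 mc2 en2]] := energy_increment gC g0 k0 e0 d0 ed gd ck irr.
have [|c1 [rc1 mc1 reg]] := H T part g c2 gk (refines_trans rc2 rc) mc2; first by lra.
exists c1; split=> //; first exact: refines_trans rc2.
by move=> x; rewrite ge_min mc1.
Qed.

Lemma weak_regularity (e k : K) : 0 < e -> 0 < k ->
  exists k1 b : K, [/\ 0 < k1, 0 < b &
    forall (T : finType) (part : T -> nat) (g : T -> T -> K) (c : T -> nat),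
      sparse_kernel part g d b -> refines c part -> minblock k c ->
      exists c1, [/\ refines c1 c, minblock k1 c1 & minorant e g (cexp c1 g)]].
Proof.
(* Capping the precision at [8 * d] keeps the splitting ratio [e' / (8 * d)] at most 1. *)
move=> e_gt0 k0; pose e' := Num.min e (8 * d).
have e0 : 0 < e' by rewrite lt_min e_gt0 mulr_gt0.
have e'd : e' <= 8 * d by rewrite ge_min lexx orbT.
have e'e : e' <= e by rewrite ge_min lexx.
have t0 : 0 < e' ^+ 2 / 4 by rewrite divr_gt0 ?exprn_gt0.
have [m hm] := archi_multiple 3 t0.
have [k1 [b [k10 b0 H]]] := weak_regularity_step m e0 e'd k0.
exists k1, b; split=> // T part g c gk rc ck.
have [|c1 [? ? reg]] := H T part g c gk rc ck.
  by apply: le_trans (ksq_ge0 _); rewrite subr_le0.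
exists c1; split=> // u v u01 v01; apply: le_trans (reg _ _ u01 v01) _.
by rewrite lerD2l.
Qed.

(** Iterates [weak_regularity] with precision [F k] adapted to the current class size [k]. If a
    refinement gains energy at most [t], it and its predecessor are the answer; otherwise the energy
    has grown by more than [t], which the ceiling allows boundedly often. *)
Lemma strong_regularity_step (t : K) (F : K -> K) (m : nat) : 0 < t ->
  (forall k, 0 < k -> 0 < F k) ->
  forall k : K, 0 < k -> exists k0 b : K, [/\ 0 < k0, 0 < b &
    forall (T : finType) (part : T -> nat) (g : T -> T -> K) (c0 : T -> nat),
      sparse_kernel part g d b -> refines c0 part -> minblock k c0 ->
      3 - m%:R * t <= ksq (cexp c0 g) ->
      exists c c1 (l : K), [/\ k0 <= l, refines c part /\ refines c1 c, minblock l c,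
        minorant (F l) g (cexp c1 g)
        & ksq (fun x y => cexp c1 g x y - cexp c g x y) <= t]].
Proof.
move=> t0 F0; elim: m => [|m IHm] k k0.
  exists k, (k ^+ 2 / 2); split=> //; first by rewrite divr_gt0 ?exprn_gt0.
  move=> T part g c gk rc ck; rewrite mul0r subr0.
  by rewrite leNgt (energy_lt3 k0 gk rc ck).
have [k1 [b1 [k10 b10 H1]]] := weak_regularity (F0 _ k0) k0.
have [k2 [b2 [k20 b20 H2]]] := IHm _ k10.
exists (Num.min k k2), (Num.min b1 b2); split; rewrite ?lt_min ?k0 ?b10 //.
move=> T part g c gk rc ck; rewrite -natr1 => en.
have gk1 : sparse_kernel part g d b1 by apply: sparse_kernelW gk; rewrite ge_min lexx.
have gk2 : sparse_kernel part g d b2 by apply: sparse_kernelW gk; rewrite ge_min lexx orbT.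
have [c1 [rc1 mc1 reg]] := H1 T part g c gk1 rc ck.
have E := cexp_pythagoras g rc1.
case: (leP (ksq (fun x y => cexp c1 g x y - cexp c g x y)) t) => [small|big].
  by exists c, c1, k; split=> //; rewrite ge_min lexx.
have [||c2 [c3 [l [lk r2 m2 reg2 s2]]]] := H2 T part g c1 gk2 _ mc1.
- exact: refines_trans rc.
- by rewrite E; lra.
by exists c2, c3, l; split=> //; rewrite ge_min lk orbT.
Qed.

Lemma strong_regularity (t k : K) (F : K -> K) : 0 < t -> (forall k, 0 < k -> 0 < F k) ->
  0 < k -> exists k0 b : K, [/\ 0 < k0, 0 < b &
    forall (T : finType) (part : T -> nat) (g : T -> T -> K),
      sparse_kernel part g d b -> minblock k part ->
      exists c c1 (l : K), [/\ k0 <= l, refines c part /\ refines c1 c, minblock l c,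
        minorant (F l) g (cexp c1 g)
        & ksq (fun x y => cexp c1 g x y - cexp c g x y) <= t]].
Proof.
move=> t0 F0 k0; have [m hm] := archi_multiple 3 t0.
have [k1 [b [k10 b0 H]]] := strong_regularity_step m t0 F0 k0.
exists k1, b; split=> // T part g gk pk; apply: (H T part g part gk _ pk) => //.
by apply: le_trans (ksq_ge0 _); rewrite subr_le0.
Qed.

End Regularity.

(** * Counting 5-cycles in nearly full boxes *)

Section RankOne.
Variables (K : realFieldType) (T : finType).
Implicit Types (f h : pred T) (A U : T -> T -> K).

Definition box (a : K) f h : T -> T -> K := fun x y => a * (f x)%:R * (h y)%:R.
Definition mass f : K := \E_x (f x)%:R.

Lemma mass_ge0 f : 0 <= mass f.
Proof. by apply: avg_ge0 => x; rewrite ler0n. Qed.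

Lemma kmul_box (a b : K) f h l : kmul (box a f h) (box b h l) = box (a * b * mass h) f l.
Proof.
apply/funext => x; apply/funext => z; rewrite /kmul /box /mass.
have -> : a * b * (\E_y (h y)%:R) * (f x)%:R * (l z)%:R =
    a * b * (f x)%:R * (l z)%:R * \E_y (h y)%:R by ring.
rewrite -avgZl; apply: eq_avg => y.
by case: (h y); rewrite ?(mulr1, mulr0, mul0r) //; ring.
Qed.

Lemma ktr_box (a : K) f : ktr (box a f f) = a * mass f.
Proof.
rewrite /ktr /mass -avgZl; apply: eq_avg => x; rewrite /box.
by case: (f x); rewrite ?(mulr1, mulr0).
Qed.

Lemma box_ge0 (a : K) f h : 0 <= a -> knneg (box a f h).
Proof. by move=> a0 x y; rewrite !mulr_ge0 ?ler0n. Qed.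

Lemma kle_box_mul (a b : K) f h l A U : knneg A -> knneg U ->
  kle A (box a f h) -> kle U (box b h l) -> kle (kmul A U) (box (a * b * mass h) f l).
Proof. by move=> A0 U0 Aa Ub; rewrite -kmul_box; apply: kle_mul. Qed.

(** The other four factors lie below boxes, so their product is at most [a ^+ 4] times the masses of
    the three inner sets; this multiplies the average defect [e]. *)
Lemma ktr5_box_step (a e : K) f1 f2 f3 f4 f5 U A2 A3 A4 A5 : 0 <= a ->
  kle U (box a f1 f2) -> \E_x \E_y (box a f1 f2 x y - U x y) <= e ->
  [/\ knneg A2, knneg A3, knneg A4 & knneg A5] ->
  [/\ kle A2 (box a f2 f3), kle A3 (box a f3 f4), kle A4 (box a f4 f5)
    & kle A5 (box a f5 f1)] ->
  ktr5 (box a f1 f2) A2 A3 A4 A5 <=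
  ktr5 U A2 A3 A4 A5 + a ^+ 4 * (mass f3 * mass f4 * mass f5) * e.
Proof.
move=> a0 Ua Ue [p2 p3 p4 p5] [q2 q3 q4 q5].
have -> : box a f1 f2 = fun x y => U x y + (box a f1 f2 x y - U x y).
  by apply/funext => x; apply/funext => y; rewrite addrCA subrr addr0.
rewrite /ktr5 kmulDl ktrD lerD2l.
set b := a ^+ 4 * (mass f3 * mass f4 * mass f5).
have b0 : 0 <= b by rewrite /b mulr_ge0 ?exprn_ge0 // mulr_ge0 ?mass_ge0 // mulr_ge0 ?mass_ge0.
have bE : b = a * (a * (a * a * mass f5) * mass f4) * mass f3 by rewrite /b; ring.
have B : kle (kmul A2 (kmul A3 (kmul A4 A5))) (box b f2 f1).
  have p45 := knneg_mul p4 p5; have p345 := knneg_mul p3 p45.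
  by rewrite bE; do 3!apply: kle_box_mul => //.
apply: (le_trans (ktr_mul_le (c := b) _ _)).
- by move=> x y; rewrite subr_ge0.
- move=> x y; apply: le_trans (B x y) _; rewrite /box -mulrA ler_piMr //.
  by case: (f2 x); case: (f1 y); rewrite ?(mulr1, mulr0) ?ler01.
by rewrite ler_wpM2l.
Qed.

(** Each of the five replacements, brought to the front by rotation, loses a tenth of the full box
    count, so half of it remains. *)
Lemma ktr5_lower_bound (a : K) f1 f2 f3 f4 f5 U1 U2 U3 U4 U5 : 0 <= a ->
  [/\ knneg U1, knneg U2, knneg U3, knneg U4 & knneg U5] ->
  [/\ kle U1 (box a f1 f2), kle U2 (box a f2 f3), kle U3 (box a f3 f4),
      kle U4 (box a f4 f5) & kle U5 (box a f5 f1)] ->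
  let miss f h U := \E_x \E_y (box a f h x y - U x y) <= a * (mass f * mass h / 10) in
  [/\ miss f1 f2 U1, miss f2 f3 U2, miss f3 f4 U3, miss f4 f5 U4 & miss f5 f1 U5] ->
  a ^+ 5 * (mass f1 * mass f2 * mass f3 * mass f4 * mass f5) / 2 <= ktr5 U1 U2 U3 U4 U5.
Proof.
move=> a0 [p1 p2 p3 p4 p5] [q1 q2 q3 q4 q5] miss [m1 m2 m3 m4 m5].
have J0 f h : knneg (box a f h) by exact: box_ge0.
have JJ f h : kle (box a f h) (box a f h) by move=> x y.
have s1 := ktr5_box_step a0 q1 m1 (And4 (J0 f2 f3) (J0 f3 f4) (J0 f4 f5) (J0 f5 f1))
  (And4 (JJ _ _) (JJ _ _) (JJ _ _) (JJ _ _)).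
have s2 := ktr5_box_step a0 q2 m2 (And4 (J0 f3 f4) (J0 f4 f5) (J0 f5 f1) p1)
  (And4 (JJ _ _) (JJ _ _) (JJ _ _) q1).
have s3 := ktr5_box_step a0 q3 m3 (And4 (J0 f4 f5) (J0 f5 f1) p1 p2)
  (And4 (JJ _ _) (JJ _ _) q1 q2).
have s4 := ktr5_box_step a0 q4 m4 (And4 (J0 f5 f1) p1 p2 p3) (And4 (JJ _ _) q1 q2 q3).
have s5 := ktr5_box_step a0 q5 m5 (And4 p1 p2 p3 p4) (And4 q1 q2 q3 q4).
have s0 : ktr5 (box a f1 f2) (box a f2 f3) (box a f3 f4) (box a f4 f5) (box a f5 f1) =
    a ^+ 5 * (mass f1 * mass f2 * mass f3 * mass f4 * mass f5).
  by rewrite /ktr5 !kmul_box ktr_box; ring.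
move: s1 s2 s3 s4 s5; rewrite s0 (ktr5_rot U1) (ktr5_rot U2) (ktr5_rot U3) (ktr5_rot U4) (ktr5_rot U5).
lra.
Qed.

End RankOne.

(** * Restriction to blocks and the L^2 bound for two-step paths *)

Section Removal.
Variables (K : realFieldType) (T : finType).
Implicit Types (c part : T -> nat) (g : T -> T -> K).

Definition restrict (f h : pred T) g : T -> T -> K := fun x y => (f x)%:R * (h y)%:R * g x y.

Definition between part g (x y : T) : T -> T -> K :=
  restrict (fun z => part x == part z) (fun z => part y == part z) g.

Lemma minorant_restrict (e : K) f h g W U : minorant e g W ->
  kle U (restrict f h W) -> minorant e (restrict f h g) U.
Proof.
move=> gW UW u v u01 v01.
have w01 (w : T -> K) (p : pred T) : weight w -> weight (fun x => w x * (p x)%:R).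
  by move=> H x; have := H x; case: (p x); rewrite ?(mulr1, mulr0) ?lexx ?ler01.
have E A : kform u (restrict f h A) v =
    kform (fun x => u x * (f x)%:R) A (fun x => v x * (h x)%:R).
  by apply: eq_avg => x; apply: eq_avg => y; rewrite /restrict; ring.
rewrite E; apply: le_trans (gW _ _ (w01 _ f u01) (w01 _ h v01)); rewrite -E.
apply: ler_avg => x; apply: ler_avg => y.
have /andP[u0 _] := u01 x; have /andP[v0 _] := v01 y.
by rewrite ler_wpM2r // ler_wpM2l.
Qed.

Lemma restrict_le f h g : knneg g -> kle (restrict f h g) g.
Proof.
move=> g0 x y; rewrite /restrict; have := g0 x y.
by case: (f x); case: (h y); rewrite ?(mulr1, mulr0, mul1r, mul0r).
Qed.

Lemma restrict_ge0 f h g : knneg g -> knneg (restrict f h g).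
Proof. by move=> g0 x y; rewrite !mulr_ge0 ?ler0n. Qed.

(** Dropping the outer restrictions and expanding the square gives two endpoints and two midpoints.
    Averaging over the endpoints first leaves the squared codegree of the midpoints, which [h]
    confines to one part. *)
Lemma two_step_l2 part (C : K) g (f h l : pred T) : (forall x y, g x y = g y x) -> knneg g ->
  (forall x y, h x -> h y -> part x = part y) ->
  \E_x \E_y ((part x == part y)%:R * codeg g x y ^+ 2) <= C ->
  \E_x \E_z (kmul (restrict f h g) (restrict h l g) x z ^+ 2) <= C.
Proof.
move=> gC g0 hpart; apply: le_trans.
have P0 : knneg (kmul (restrict f h g) (restrict h l g)).
  by apply: knneg_mul; apply: restrict_ge0.
apply: le_trans (_ : \E_x \E_z ((\E_y ((h y)%:R * g x y * g y z)) ^+ 2) <= _).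
  apply: ler_avg => x; apply: ler_avg => z; rewrite ler_pXn2r ?nnegrE //; last first.
    by apply: avg_ge0 => y; rewrite !mulr_ge0 ?ler0n.
  apply: ler_avg => y; rewrite /restrict; have := g0 x y; have := g0 y z.
  by case: (f x); case: (h y); case: (l z) => ? ?; rewrite ?(mulr1, mulr0, mul1r, mul0r) ?mulr_ge0.
have -> : \E_x \E_z ((\E_y ((h y)%:R * g x y * g y z)) ^+ 2) =
  \E_x \E_z \E_y \E_t ((h y)%:R * (h t)%:R * (g y x * g t x) * (g y z * g t z)).
  apply: eq_avg => x; apply: eq_avg => z; rewrite expr2 -avgZr; apply: eq_avg => y.
  rewrite -avgZl; apply: eq_avg => t; rewrite (gC y x) (gC t x); ring.
under eq_avg do rewrite avg_exchange.
rewrite avg_exchange; apply: ler_avg => y.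
under eq_avg => x do rewrite avg_exchange.
rewrite avg_exchange; apply: ler_avg => t.
have -> : \E_x \E_z ((h y)%:R * (h t)%:R * (g y x * g t x) * (g y z * g t z)) =
    (h y)%:R * (h t)%:R * codeg g y t ^+ 2.
  rewrite expr2 mulrA {1}/codeg -avgZl -avgZr; apply: eq_avg => x.
  by rewrite avgZl.
rewrite ler_wpM2r ?sqr_ge0 // -natrM ler_nat.
by case hy: (h y); case ht: (h t) => //; rewrite (hpart _ _ hy ht) eqxx.
Qed.

End Removal.

(** * Cleaning the graph and counting around a surviving 5-cycle *)

Lemma expr5_le_prod (K : realDomainType) (l a1 a2 a3 a4 a5 : K) : 0 <= l ->
  l <= a1 -> l <= a2 -> l <= a3 -> l <= a4 -> l <= a5 -> l ^+ 5 <= a1 * a2 * a3 * a4 * a5.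
Proof.
move=> l0 ? ? ? ? ?; rewrite !exprS expr0 mulr1 !mulrA.
by do 4?(apply: ler_pM => //; do ?apply: mulr_ge0 => //).
Qed.

Section BlockRemoval.
Variable K : archiRealFieldType.

Definition rel_kernel (T : finType) (s : K) (G : rel T) : T -> T -> K :=
  fun x y => s * (G x y)%:R.

Section Cleaning.
Variables (T : finType) (s : K) (G : rel T) (c c1 : T -> nat) (eta tau : K).
Hypotheses (s0 : 0 <= s) (GC : symmetric G).
Hypotheses (eta0 : 0 < eta) (tau0 : 0 < tau).

Let g := rel_kernel s G.
Let W := cexp c g.
Let W1 := cexp c1 g.
(** The mean square deviation of [W1] from [W] on each block of [c]. *)
Let V := cexp c (fun x y => (W1 x y - W x y) ^+ 2).

Definition cleaned : rel T := fun x y => [&& G x y, eta <= W x y & V x y <= tau].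

Let gC x y : g x y = g y x. Proof. by rewrite /g /rel_kernel GC. Qed.
Let g0 : knneg g. Proof. by move=> x y; rewrite mulr_ge0 ?ler0n. Qed.
Let V0 : knneg V. Proof. by apply: cexp_ge0 => x y; apply: sqr_ge0. Qed.
Let W0 : knneg W. Proof. exact: cexp_ge0. Qed.

Lemma cleaned_sym : symmetric cleaned.
Proof.
have WC t z : W t z = W z t by exact: cexp_sym.
have W1C t z : W1 t z = W1 z t by exact: cexp_sym.
have VC t z : V t z = V z t by apply: cexp_sym => p q; rewrite WC W1C.
by move=> x y; rewrite /cleaned GC WC VC.
Qed.

Lemma cleaned_sub : subrel cleaned G.
Proof. by move=> x y /and3P[]. Qed.

(** Each deletion rule selects whole blocks of [c], so the mass of [g] there equals that of [W].
    Light blocks contribute at most [eta]; on irregular ones [W <= r * W ^+ 2 + V / (tau * r)]. *)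
Lemma cleaned_cost (r t : K) : 0 < r -> ksq W <= 3 ->
  ksq (fun x y => W1 x y - W x y) <= t ->
  \E_x \E_y (g x y - rel_kernel s cleaned x y) <= eta + 3 * r + t / (tau * r).
Proof.
move=> r0 W3 Wt.
pose p x y : K := (W x y < eta)%O%:R; pose q x y : K := (tau < V x y)%O%:R.
have inv (F : T -> T -> K) : invl c (cexp c F) by apply: invl_cexp.
have inv' (F : T -> T -> K) : invr c (cexp c F) by apply: invr_cexp.
have pg : kip p g = kip p W.
  by rewrite kip_cexp // => x y z cxy; rewrite /p /W ?(inv _ _ _ _ cxy) ?(inv' _ _ _ _ cxy).
have qg : kip q g = kip q W.
  by rewrite kip_cexp // => x y z cxy; rewrite /q /V ?(inv _ _ _ _ cxy) ?(inv' _ _ _ _ cxy).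
apply: le_trans (_ : kip p g + kip q g <= _).
  rewrite /kip -avgD; apply: ler_avg => x; rewrite -avgD; apply: ler_avg => y.
  rewrite /g /rel_kernel /cleaned -/g -/W -/V /p /q.
  have sG : 0 <= s * (G x y)%:R by rewrite mulr_ge0 ?ler0n.
  case: (G x y) sG => /= sG; last by rewrite mulr0 subrr !mulr0 addr0.
  case: (leP eta (W x y)) => /= _; case: (leP (V x y) tau) => /= _;
    move: sG; rewrite ?mulr1 ?mulr0; lra.
rewrite pg qg -addrA; apply: lerD.
  apply: avg_le_cst => [|x]; first exact: ltW.
  apply: avg_le_cst => [|y]; first exact: ltW.
  by rewrite /p; case: (ltP (W x y) eta) => H; rewrite ?mulr1n ?mulr0n ?mul1r ?mul0r ltW.
have EV : ksq (fun x y => W1 x y - W x y) = \E_x \E_y V x y.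
  have -> : \E_x \E_y V x y = kip (fun _ _ => 1) V.
    by apply: eq_avg => x; apply: eq_avg => y; rewrite mul1r.
  by rewrite kip_cexp //; apply: eq_avg => x; apply: eq_avg => y; rewrite mul1r.
apply: le_trans (_ : r * ksq W + (tau * r)^-1 * \E_x \E_y V x y <= _); last first.
  by rewrite mulrC -EV lerD ?ler_wpM2r ?(ltW r0) // mulrC ler_wpM2r // invr_ge0 mulr_ge0 ?ltW.
rewrite -!avgZl -avgD; apply: ler_avg => x; rewrite -!avgZl -avgD; apply: ler_avg => y.
have Vxy := V0 x y; have Wxy := W0 x y.
rewrite /q; case: ltP => H; rewrite ?mulr1n ?mulr0n; last first.
  rewrite mul0r; apply: addr_ge0; apply: mulr_ge0 => //; rewrite ?sqr_ge0 ?(ltW r0) //.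
  by rewrite invr_ge0 ltW // mulr_gt0.
have : r^-1 <= (tau * r)^-1 * V x y.
  by rewrite invfM mulrAC ler_peMl ?invr_ge0 ?(ltW r0) // mulrC ler_pdivlMr // mul1r ltW.
(* The square yields [W <= r * W ^+ 2 + r^-1 / 4], and [r^-1] is at most [V / (tau * r)] where
   [V > tau]. *)
have : 0 <= r * (W x y - r^-1 / 2) ^+ 2 by rewrite mulr_ge0 ?sqr_ge0 ?ltW.
have -> : r * (W x y - r^-1 / 2) ^+ 2 = r * W x y ^+ 2 - W x y + r^-1 / 4.
  by field; rewrite gt_eqF.
have : 0 < r^-1 by rewrite invr_gt0.
rewrite mul1r; lra.
Qed.

Definition block (x : T) : pred T := fun y => c x == c y.

(** A two-valued kernel lying below both [W1] and the full box of height [eta / 2]: the first makes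
    it a minorant, the second suits the box count. *)
Definition dense_part (x y : T) : T -> T -> K :=
  fun u v => (block x u)%:R * (block y v)%:R * (eta / 2) * (eta / 2 <= W1 u v)%O%:R.

(** Chebyshev: [W >= eta] on the whole block, so [W1 < eta / 2] forces a squared deviation of at
    least [eta ^+ 2 / 4]; the value of [tau] turns this into one tenth. *)
Lemma dense_part_miss x y : tau = eta ^+ 2 / 40 -> cleaned x y ->
  \E_u \E_v (box (eta / 2) (block x) (block y) u v - dense_part x y u v) <=
    eta / 2 * (mass K (block x) * mass K (block y) / 10).
Proof.
move=> tauE /and3P[_ Wxy Vxy].
have H : \E_u \E_v ((block x u)%:R * (block y v)%:R * (W1 u v - W u v) ^+ 2) <=
   mass K (block x) * mass K (block y) * tau.
  have -> : \E_u \E_v ((block x u)%:R * (block y v)%:R * (W1 u v - W u v) ^+ 2) =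
    mass K (block x) * mass K (block y) * V x y by rewrite -cexp_block.
  by rewrite ler_wpM2l // mulr_ge0 ?mass_ge0.
apply: le_trans (_ : 2 / eta * (mass K (block x) * mass K (block y) * tau) <= _); last first.
  have -> : eta / 2 * (mass K (block x) * mass K (block y) / 10) =
    2 / eta * (mass K (block x) * mass K (block y) * tau).
    by rewrite tauE; field; rewrite gt_eqF.
  exact: lexx.
apply: le_trans (ler_wpM2l _ H); last by rewrite divr_ge0 // ltW.
rewrite -avgZl; apply: ler_avg => u; rewrite -avgZl; apply: ler_avg => v.
rewrite /box /dense_part.
case xu: (block x u); last by rewrite !(mulr0, mul0r) subrr.
case yv: (block y v); last by rewrite !(mulr0, mul0r) subrr.
have Wuv : eta <= W u v.
  have Wl : invl c W by apply: invl_cexp.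
  have Wr : invr c W by apply: invr_cexp.
  by rewrite -(Wl _ _ v (eqP xu)) -(Wr _ _ x (eqP yv)).
rewrite !mulr1n !mul1r !mulr1; case: (leP (eta / 2) (W1 u v)) => W1uv; rewrite ?mulr1n ?mulr0n.
  by rewrite mulr1 subrr mulr_ge0 ?sqr_ge0 // divr_ge0 // ltW.
rewrite mulr0 subr0 mulrAC ler_pdivlMr //.
have -> : (W1 u v - W u v) ^+ 2 = (W u v - W1 u v) ^+ 2 by rewrite -sqrrN opprB.
have : (eta / 2) ^+ 2 <= (W u v - W1 u v) ^+ 2.
  rewrite -subr_ge0 subr_sqr; apply: mulr_ge0; move: eta0 Wuv W1uv; lra.
rewrite expr2; lra.
Qed.

End Cleaning.

(** The box count is bounded below only in terms of the class size [l], so the precision has to be a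
    function [F] of [l]; this is what strong regularity supplies. *)
Lemma five_cycle_blocks (d C eta : K) : 0 < d -> 0 < C -> 0 < eta <= 1 ->
  exists F : K -> K, (forall l, 0 < l -> 0 < F l) /\
  forall (T : finType) (part : T -> nat) (G : rel T) (s : K) (c c1 : T -> nat) (l : K),
    0 <= s -> symmetric G -> refines c part -> refines c1 c -> 0 < l -> minblock l c ->
    rows_le (rel_kernel s G) d ->
    minorant (F l) (rel_kernel s G) (cexp c1 (rel_kernel s G)) ->
    \E_x \E_y ((part x == part y)%:R * codeg (rel_kernel s G) x y ^+ 2) <= C ->
    forall x1 x2 x3 x4 x5,
      let H := cleaned s G c c1 eta (eta ^+ 2 / 40) in
      [/\ H x1 x2, H x2 x3, H x3 x4, H x4 x5 & H x5 x1] ->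
      let sg := between part (rel_kernel s G) in
      ((eta / 2) ^+ 5 * l ^+ 5 / 4 <=
      ktr5 (sg x1 x2) (sg x2 x3) (sg x3 x4) (sg x4 x5) (sg x5 x1) : Prop).
Proof.
move=> d0 C0 /andP[eta0 eta1].
(* [L] bounds the dense count from below. The height [M] makes the truncation error [L / 4], and
   precision [L / 4 / D] makes the regularity error [L / 4], so half of [L] is left. *)
pose L (l : K) := (eta / 2) ^+ 5 * l ^+ 5 / 2.
pose M l := 4 * (d ^+ 2 + d) * C / L l.
pose D l := M l ^+ 2 + d * M l + d ^+ 2 + d + 1.
have L0 l : 0 < l -> 0 < L l by move=> l0; rewrite /L divr_gt0 // mulr_gt0 // exprn_gt0 // divr_gt0.
have M0 l : 0 < l -> 0 < M l.
  move=> l0; rewrite /M divr_gt0 ?L0 // mulr_gt0 // mulr_gt0 //.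
  by rewrite addr_gt0 // exprn_gt0.
have D0 l : 0 < l -> 0 < D l.
  move=> /M0 m0; have : 0 < d * M l by rewrite mulr_gt0.
  have : 0 < M l ^+ 2 by rewrite exprn_gt0.
  have : 0 < d ^+ 2 by rewrite exprn_gt0.
  rewrite /D; lra.
have F0 l : 0 < l -> 0 < L l / 4 / D l by move=> l0; rewrite divr_gt0 ?D0 // divr_gt0 ?L0.
exists (fun l => L l / 4 / D l); split=> //.
move=> T part G s c c1 l s0 GC rcp rc l0 lc gd reg g2 x1 x2 x3 x4 x5 H [h1 h2 h3 h4 h5] sg.
pose g := rel_kernel s G; pose tau := eta ^+ 2 / 40.
have gC x y : g x y = g y x by rewrite /g /rel_kernel GC.
have g0 : knneg g by move=> x y; rewrite mulr_ge0 ?ler0n.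
have tau0 : 0 < tau by rewrite divr_gt0 ?exprn_gt0.
pose gg x y := restrict (block c x) (block c y) g.
pose U x y := dense_part s G c c1 eta x y.
have gg0 x y : knneg (gg x y) by exact: restrict_ge0.
have e20 : 0 <= eta / 2 by rewrite ltW ?divr_gt0.
have U0 x y : knneg (U x y).
  by move=> u v; rewrite /U /dense_part mulr_ge0 ?ler0n // mulr_ge0 // mulr_ge0 ?ler0n.
have Ubox x y : kle (U x y) (box (eta / 2) (block c x) (block c y)).
  move=> u v; rewrite /U /dense_part /box.
  by case: (block c x u); case: (block c y v); case: (leP (eta / 2) _) => _;
    rewrite ?mulr1n ?mulr0n ?(mulr1, mulr0, mul1r, mul0r).
have gg_row x y : rows_le (gg x y) d.
  move=> u; apply: le_trans (gd u); apply: ler_avg => v; exact: restrict_le.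
have gg_col x y : cols_le (gg x y) d.
  move=> u; apply: le_trans (gd u); apply: ler_avg => v.
  by rewrite -/g (gC u v); apply: restrict_le.
have Ubound x y : kbound (U x y) 1.
  move=> u v; rewrite U0 /=; apply: le_trans (Ubox x y u v) _; rewrite /box.
  by case: (block c x u); case: (block c y v); rewrite ?(mulr1, mulr0); lra.
have Umin x y : minorant (L l / 4 / D l) (gg x y) (U x y).
  apply: minorant_restrict reg _ => u v; rewrite /U /dense_part /restrict.
  rewrite -mulrA ler_wpM2l ?mulr_ge0 ?ler0n //.
  by case: (leP (eta / 2) (cexp c1 g u v)) => W1; rewrite ?mulr1n ?mulr0n ?(mulr1, mulr0) //; apply: cexp_ge0.
have l2 x y z : \E_u \E_v (kmul (gg x y) (gg y z) u v ^+ 2) <= C.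
  apply: (two_step_l2 _ _ gC g0 _ g2) => u v /eqP yu /eqP yv; apply: rcp.
  by rewrite -yu.
have count := counting_lemma (ltW (F0 _ l0)) d0 (M0 _ l0)
  (And5 (gg0 x1 x2) (gg0 x2 x3) (gg0 x3 x4) (gg0 x4 x5) (gg0 x5 x1))
  (And4 (gg_col x1 x2) (gg_col x2 x3) (gg_col x4 x5) (gg_col x5 x1))
  (gg_row x1 x2) (gg_row x5 x1)
  (And5 (Ubound x1 x2) (Ubound x2 x3) (Ubound x3 x4) (Ubound x4 x5) (Ubound x5 x1))
  (And5 (Umin x1 x2) (Umin x2 x3) (Umin x3 x4) (Umin x4 x5) (Umin x5 x1))
  (l2 x1 x2 x3) (l2 x4 x5 x1).
have miss x y : H x y -> \E_u \E_v (box (eta / 2) (block c x) (block c y) u v - U x y u v) <=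
    eta / 2 * (mass K (block c x) * mass K (block c y) / 10).
  by move=> hxy; apply: (dense_part_miss eta0 erefl hxy).
have low := ktr5_lower_bound e20
  (And5 (U0 x1 x2) (U0 x2 x3) (U0 x3 x4) (U0 x4 x5) (U0 x5 x1))
  (And5 (Ubox x1 x2) (Ubox x2 x3) (Ubox x3 x4) (Ubox x4 x5) (Ubox x5 x1))
  (And5 (miss _ _ h1) (miss _ _ h2) (miss _ _ h3) (miss _ _ h4) (miss _ _ h5)).
have Llow : L l <= ktr5 (U x1 x2) (U x2 x3) (U x3 x4) (U x4 x5) (U x5 x1).
  apply: le_trans low; rewrite /L ler_wpM2r ?invr_ge0 // ler_wpM2l ?exprn_ge0 //.
  have lx x : l <= mass K (block c x) := lc x.
  exact: expr5_le_prod (ltW l0) _ _ _ _ _.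
have ggsg : ktr5 (gg x1 x2) (gg x2 x3) (gg x3 x4) (gg x4 x5) (gg x5 x1) <=
            ktr5 (sg x1 x2) (sg x2 x3) (sg x3 x4) (sg x4 x5) (sg x5 x1).
  have le x y : kle (gg x y) (sg x y).
    move=> u v; rewrite /gg /sg /between /restrict ler_wpM2r // -!natrM ler_nat leq_mul // /block.
      by case: eqP => // /rcp ->; rewrite eqxx.
    by case: eqP => // /rcp ->; rewrite eqxx.
  have p45 := knneg_mul (gg0 x4 x5) (gg0 x5 x1); have p345 := knneg_mul (gg0 x3 x4) p45.
  have p2345 := knneg_mul (gg0 x2 x3) p345.
  by apply: ler_ktr; do 4!apply: kle_mul => //.
apply: le_trans ggsg.
have E1 : (M l ^+ 2 + d * M l + d ^+ 2 + d + 1) * (L l / 4 / D l) = L l / 4.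
  by rewrite -/(D l) mulrC divfK // gt_eqF ?D0.
have E2 : (d ^+ 2 + d) * C / M l = L l / 4.
  rewrite /M; field; rewrite !gt_eqF ?L0 //.
  by rewrite addr_gt0 // exprn_gt0.
have E3 : (eta / 2) ^+ 5 * l ^+ 5 / 4 = L l / 2 by rewrite /L; field.
move: count Llow; rewrite E1 E2 E3; lra.
Qed.

Theorem sparse_five_cycle_removal (d C k eps : K) : 0 < d -> 0 < C -> 0 < k -> 0 < eps ->
  exists b gam : K, [/\ 0 < b, 0 < gam &
    forall (T : finType) (part : T -> nat) (G : rel T) (s : K),
      0 <= s -> symmetric G -> minblock k part ->
      sparse_kernel part (rel_kernel s G) d b ->
      \E_x \E_y ((part x == part y)%:R * codeg (rel_kernel s G) x y ^+ 2) <= C ->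
      exists H : rel T, [/\ symmetric H, subrel H G,
        \E_x \E_y (rel_kernel s G x y - rel_kernel s H x y) <= eps &
        forall x1 x2 x3 x4 x5, [/\ H x1 x2, H x2 x3, H x3 x4, H x4 x5 & H x5 x1] ->
        let sg := between part (rel_kernel s G) in
        (gam <= ktr5 (sg x1 x2) (sg x2 x3) (sg x3 x4) (sg x4 x5) (sg x5 x1) : Prop)]].
Proof.
move=> d0 C0 k0 eps0.
(* The three terms of [cleaned_cost], namely [eta], [3 * r] and [t / (tau * r)], are each made at
   most [eps / 3]. *)
pose eta := Num.min (eps / 3) 1.
have eta01 : 0 < eta <= 1 by rewrite lt_min ltr01 divr_gt0 //= ge_min lexx orbT.
have /andP[eta0 _] := eta01.
have eta_eps : eta <= eps / 3 by rewrite ge_min lexx.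
pose tau := eta ^+ 2 / 40; have tau0 : 0 < tau by rewrite divr_gt0 ?exprn_gt0.
pose r := eps / 9; have r0 : 0 < r by rewrite divr_gt0.
pose t := tau * r * (eps / 3); have t0 : 0 < t by rewrite /t mulr_gt0 ?divr_gt0 // mulr_gt0.
have [F [F0 HF]] := five_cycle_blocks d0 C0 eta01.
have [k1 [b [k10 b0 HR]]] := strong_regularity d0 t0 F0 k0.
(* The bound [k1 ^+ 2] keeps the energy of the coarse partition at most 3, as its classes have
   measure at least [k1]. *)
exists (Num.min b (k1 ^+ 2)), ((eta / 2) ^+ 5 * k1 ^+ 5 / 4); split.
- by rewrite lt_min b0 exprn_gt0.
- by rewrite divr_gt0 // mulr_gt0 // exprn_gt0 // divr_gt0.
move=> T part G s s0 GC kpart gk g2.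
have gkb : sparse_kernel part (rel_kernel s G) d b by apply: sparse_kernelW gk; rewrite ge_min lexx.
have gkk : sparse_kernel part (rel_kernel s G) d (k1 ^+ 2).
  by apply: sparse_kernelW gk; rewrite ge_min lexx orbT.
have [c [c1 [l [k1l [rcp rc] lc reg tc]]]] := HR T part _ gkb kpart.
have l0 : 0 < l by apply: lt_le_trans k1l.
exists (cleaned s G c c1 eta tau); split.
- exact: cleaned_sym.
- exact: cleaned_sub.
- apply: le_trans (cleaned_cost s0 eta0 tau0 r0 _ tc) _.
    apply: le_trans (cexp_energy gkk l0 rcp lc) _.
    have : k1 ^+ 2 / l ^+ 2 <= 1.
      by rewrite ler_pdivrMr ?exprn_gt0 // mul1r ler_pXn2r // nnegrE ltW.
    lra.
  have -> : t / (tau * r) = eps / 3 by rewrite /t; field; rewrite !gt_eqF.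
  rewrite /r; lra.
move=> x1 x2 x3 x4 x5 hx sg; have [_ _ gd _] := gk.
apply: le_trans (HF T part G s c c1 l s0 GC rcp rc l0 lc gd reg g2 x1 x2 x3 x4 x5 hx).
by rewrite ler_wpM2r ?invr_ge0 // ler_wpM2l ?exprn_ge0 ?divr_ge0 ?(ltW eta0) //
  ler_pXn2r ?nnegrE ?(ltW k10) ?(ltW l0).
Qed.

End BlockRemoval.

(** * From copies of cycles to labelled cycles *)

Section CopyCounts.
Variables (T : finType) (G : rel T).

Lemma cover_cyc_edges (k : nat) (f : 'I_k -> T) : cover (cyc_edges k f) = f @: 'I_k.
Proof.
apply/setP => x; apply/bigcupP/imsetP => [[e /imsetP[i _ ->]]|[i _ ->]].
  by rewrite !inE => /orP[]/eqP ->; [exists i | exists (ordS i)].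
by exists [set f i; f (ordS i)]; [exact: imset_f | rewrite !inE eqxx].
Qed.

(** A map producing a given copy takes values in the vertex set covered by its edges, which has at
    most [k] elements; hence at most [k ^ k] maps per copy. *)
Lemma hom_count (k : nat) (P : pred {ffun 'I_k -> T}) :
  (#|[set f : {ffun 'I_k -> T} | [&& injectiveb f, P f & [forall i, G (f i) (f (ordS i))]]]|
    <= k ^ k * #|copies_with G k P|)%N.
Proof.
set A := [set f | _].
rewrite -sum1_card (partition_big (fun f : {ffun 'I_k -> T} => cyc_edges k f)
  (fun E => E \in copies_with G k P)) /=; last first.
  move=> f; rewrite inE => /and3P[f1 f2 f3]; rewrite inE; apply/existsP; exists f.
  by rewrite f1 f2 f3 eqxx.
rewrite mulnC -sum_nat_const; apply: leq_sum => E; rewrite inE => /existsP[f0 /and4P[_ _ _ /eqP EE]].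
rewrite sum1dep_card -[X in (k ^ X)%N](card_ord k).
apply: leq_trans (_ : #|ffun_on (mem (cover E)) : pred {ffun 'I_k -> T}| <= _)%N.
  apply: subset_leq_card; apply/subsetP => f; rewrite inE => /andP[_ /eqP fE].
  by apply/ffun_onP => i; rewrite -fE cover_cyc_edges; apply: imset_f.
rewrite card_ffun_on card_ord; have [k0|k0] := posnP k; first by rewrite [X in (_ ^ X <= _ ^ X)%N]k0.
rewrite leq_exp2r // EE cover_cyc_edges; apply: leq_trans (leq_imset_card _ _) _.
by rewrite card_ord.
Qed.

Definition seq_fun (k : nat) (x0 : T) (s : seq T) : {ffun 'I_k -> T} := [ffun i : 'I_k => nth x0 s i].

Lemma seq_fun_inj (k : nat) (x0 : T) (s : seq T) : size s = k -> uniq s -> injectiveb (seq_fun k x0 s).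
Proof.
move=> sk us; apply/injectiveP => i j; rewrite !ffunE => /eqP.
by rewrite nth_uniq ?sk ?ltn_ord // => /eqP/val_inj.
Qed.

Lemma five_tuple_count :
  (#|[set p : T * T * T * T * T | let: (a, b, c, d, e) := p in
      [&& uniq [:: a; b; c; d; e], G a b, G b c, G c d, G d e & G e a]]|
   <= 5 ^ 5 * #|copies G 5|)%N.
Proof.
apply: leq_trans (hom_count predT); set A := [set p | _].
pose F (p : T * T * T * T * T) := let: (a, b, c, d, e) := p in
  seq_fun 5 a [:: a; b; c; d; e].
rewrite -(card_in_imset (f := F)).
  apply: subset_leq_card; apply/subsetP => f /imsetP[[[[[a b] c] d] e]].
  rewrite [_ \in A]inE => /andP[us /and5P[ab bc cd de ea]] ->.
  rewrite inE seq_fun_inj //=; apply/forallP => -[[|[|[|[|[|]]]]] //= i]; by rewrite !ffunE.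
move=> [[[[a b] c] d] e] [[[[a' b'] c'] d'] e'] _ _ /ffunP H.
have := H (@Ordinal 5 0 isT); have := H (@Ordinal 5 1 isT); have := H (@Ordinal 5 2 isT).
have := H (@Ordinal 5 3 isT); have := H (@Ordinal 5 4 isT).
by rewrite !ffunE /= => -> -> -> -> ->.
Qed.

End CopyCounts.

Lemma four_tuple_count (n : nat) (G : rel (vtx n)) :
  (#|[set p : vtx n * vtx n * vtx n * vtx n | let: (a, b, c, d) := p in
      [&& uniq [:: a; b; c; d], part a == part c, part b == part d, G a b, G b c, G c d & G d a]]|
   <= 4 ^ 4 * #|C4_two_parts G|)%N.
Proof.
apply: leq_trans (hom_count _ _); set A := [set p | _].
pose F (p : vtx n * vtx n * vtx n * vtx n) := let: (a, b, c, d) := p in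
  seq_fun 4 a [:: a; b; c; d].
rewrite -(card_in_imset (f := F)).
  apply: subset_leq_card; apply/subsetP => f /imsetP[[[[a b] c] d]].
  rewrite [_ \in A]inE => /and3P[us /eqP pac /and5P[/eqP pbd ab bc cd da]] ->.
  rewrite inE seq_fun_inj //=; apply/andP; split.
    apply/existsP; exists (part a); apply/existsP; exists (part b).
    by apply/forallP => -[[|[|[|[|]]]] //= i]; rewrite ffunE /= ?pac ?pbd eqxx ?orbT.
  by apply/forallP => -[[|[|[|[|]]]] //= i]; rewrite !ffunE.
move=> [[[a b] c] d] [[[a' b'] c'] d'] _ _ /ffunP H.
have := H (@Ordinal 4 0 isT); have := H (@Ordinal 4 1 isT); have := H (@Ordinal 4 2 isT).
have := H (@Ordinal 4 3 isT).
by rewrite !ffunE /= => -> -> -> ->.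
Qed.

(** Five steps of +1 or -1 have an odd sum between -5 and 5; it vanishes mod 5 only if all signs
    agree, so the walk visits every residue. Checked by enumeration. *)
Lemma cyclic_walk_uniq (p : seq 'I_5) :
  let next (i j : 'I_5) := (i.+1 %% 5 == j)%N || (j.+1 %% 5 == i)%N in
  size p = 5%N -> cycle next p -> uniq p.
Proof.
move=> next; rewrite -(map_inj_uniq val_inj).
pose nx (i j : nat) := (i.+1 %% 5 == j)%N || (j.+1 %% 5 == i)%N.
case: p => [|a [|b [|c [|d [|e [|]]]]]] //= _; rewrite /next andbT.
have H : all (fun a => all (fun b => all (fun c => all (fun d => all (fun e =>
   [&& nx a b, nx b c, nx c d, nx d e & nx e a] ==> uniq [:: a; b; c; d; e])
   (iota 0 5)) (iota 0 5)) (iota 0 5)) (iota 0 5)) (iota 0 5) by vm_compute.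
have io (i : 'I_5) : val i \in iota 0 5 by rewrite mem_iota ltn_ord.
have /allP/(_ _ (io b))/allP/(_ _ (io c))/allP/(_ _ (io d))/allP/(_ _ (io e)) := allP H _ (io a).
by move=> /implyP.
Qed.

Lemma sum_indicator (K : realFieldType) (S : finType) (P : pred S) :
  \sum_p (P p)%:R = #|[set p | P p]|%:R :> K.
Proof. by rewrite -natr_sum -sum1dep_card [in RHS]big_mkcond. Qed.

(** * Codegrees and degrees controlled by 4-cycles *)

Section Degrees.
Variables (K : realFieldType) (n : nat).
Implicit Types (G : rel (vtx n)) (x y z : vtx n) (X : vtx n -> vtx n -> K).

Definition adj G x y : K := (G x y)%:R.
Definition deg G x : K := \sum_y adj G x y.
Definition common G x y : K := \sum_z adj G x z * adj G y z.
Definition same x y : K := (part x == part y)%:R.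
Definition twins x y : K := ((part x == part y) && (x != y))%:R.
(** Ordered pairs of distinct common neighbours of [x] and [y] within one part. *)
Definition squares G x y : K :=
  \sum_z \sum_w twins z w * (adj G x z * adj G y z * (adj G x w * adj G y w)).

(** Ordered pairs are counted, so for symmetric graphs each lost edge counts twice. *)
Definition gap G1 G2 : K := \sum_x \sum_y (adj G1 x y - adj G2 x y).

Lemma gap_split G1 G2 G3 : gap G1 G3 = gap G1 G2 + gap G2 G3.
Proof.
rewrite -big_split; apply: eq_bigr => x _; rewrite -big_split; apply: eq_bigr => y _ /=.
by rewrite addrA subrK.
Qed.

Lemma adj_sqr G x y : adj G x y * adj G x y = adj G x y.
Proof. by rewrite /adj; case: (G x y); rewrite ?(mulr1, mulr0). Qed.

Lemma adj_ge0 G x y : 0 <= adj G x y. Proof. exact: ler0n. Qed.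

Lemma deg_ge0 G x : 0 <= deg G x. Proof. by apply: sumr_ge0 => y _; apply: adj_ge0. Qed.

Lemma card_vtx : #|{: vtx n}| = (5 * n)%N.
Proof. by rewrite card_prod !card_ord. Qed.

Lemma sum_same X :
  \sum_x \sum_y same x y * X x y = \sum_x X x x + \sum_x \sum_y twins x y * X x y.
Proof.
rewrite -big_split; apply: eq_bigr => x _ /=.
rewrite (bigD1 x) //= /same eqxx mul1r; congr (_ + _).
rewrite [RHS](bigD1 x) //= /twins !eqxx mul0r add0r.
by apply: eq_bigr => y; rewrite [x == y]eq_sym => ->; rewrite andbT.
Qed.

Lemma sqr_sum_le_same (a : vtx n -> K) :
  (\sum_x a x) ^+ 2 <= 5 * \sum_x \sum_y same x y * (a x * a y).
Proof.
pose S (i : 'I_5) := \sum_(x | part x == i) a x.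
have -> : \sum_x a x = \sum_i S i by rewrite (partition_big part xpredT).
have -> : \sum_x \sum_y same x y * (a x * a y) = \sum_i S i ^+ 2.
  rewrite (partition_big part xpredT) //=; apply: eq_bigr => i _.
  rewrite expr2 mulr_suml; apply: eq_bigr => x /eqP xi.
  rewrite /S mulr_sumr [RHS]big_mkcond; apply: eq_bigr => y _.
  by rewrite /same xi eq_sym; case: (part y == i); rewrite ?(mul1r, mul0r).
exact: sum_sqr_le.
Qed.

(* By Cauchy-Schwarz over the five parts, the common neighbours of [x] and [y] form
   many pairs inside a part, that is, many 4-cycles. *)
Lemma common_le_squares G x y : common G x y ^+ 2 <= 5 * (common G x y + squares G x y).
Proof.
apply: le_trans (sqr_sum_le_same _) _; rewrite ler_pM2l // sum_same /squares lerD2r.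
apply: ler_sum => z _; rewrite mulrACA !adj_sqr; exact: lexx.
Qed.

(** After division by 5 the constant 10 becomes the threshold 2 in [sparse_kernel]. *)
Lemma common_le G x y : common G x y <= 10 + squares G x y.
Proof.
have := common_le_squares G x y; have := sqr_ge0 (common G x y - 5).
rewrite sqrrB; lra.
Qed.

Lemma common_sqr_le G x y : common G x y ^+ 2 <= 25 + 10 * squares G x y.
Proof.
have := common_le_squares G x y; have := sqr_ge0 (common G x y - 5).
rewrite sqrrB; lra.
Qed.

Lemma squares_ge0 G x y : 0 <= squares G x y.
Proof. by apply: sumr_ge0 => z _; apply: sumr_ge0 => w _; rewrite !mulr_ge0 ?ler0n. Qed.

(** Every nonzero term is a labelled 4-cycle [x z y w] with opposite vertices in a common part, and
    256 is [4 ^ 4]. *)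
Lemma sum_squares_le G : symmetric G -> irreflexive G ->
  \sum_x \sum_y twins x y * squares G x y <= 256 * #|C4_two_parts G|%:R.
Proof.
move=> GC G0; have := four_tuple_count G; rewrite -(ler_nat K) natrM; apply: le_trans.
have -> : \sum_x \sum_y twins x y * squares G x y = \sum_x \sum_z \sum_y \sum_w
    twins x y * (twins z w * (adj G x z * adj G y z * (adj G x w * adj G y w))).
  apply: eq_bigr => x _; rewrite exchange_big; apply: eq_bigr => y _ /=.
  by rewrite mulr_sumr; apply: eq_bigr => z _; rewrite mulr_sumr.
rewrite !pair_big -sum_indicator; apply: ler_sum => -[[[x z] y] w] _ /=.
rewrite /twins /adj -!natrM ler_nat !mulnb.
case: (boolP (_ && _)) => // /and3P[/andP[pxy xy] /andP[pzw zw] /and3P[/andP[xz yz] xw yw]].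
have neq u v : G u v -> u != v by apply: contraTneq => ->; rewrite G0.
rewrite pxy pzw xz (GC z) yz yw (GC w) xw !inE !negb_or xy zw !neq //.
by rewrite GC.
Qed.

Lemma common_diag G x : common G x x = deg G x.
Proof. by apply: eq_bigr => z _; rewrite adj_sqr. Qed.

(** Cauchy-Schwarz over the parts bounds squared degrees by pairs of neighbours within a part, that
    is, by codegrees inside parts. *)
Lemma sum_deg_sqr_le G : symmetric G -> irreflexive G ->
  \sum_x deg G x ^+ 2 <= 125 * n%:R + 2500 * n%:R ^+ 2 + 2560 * #|C4_two_parts G|%:R.
Proof.
move=> GC G0.
have cst (c : K) : \sum_(x : vtx n) c = 5 * n%:R * c.
  by rewrite sumr_const card_vtx -[LHS]mulr_natl natrM.
have s1 : \sum_x deg G x ^+ 2 <= 5 * \sum_x \sum_y same x y * common G x y.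
  apply: le_trans (_ : \sum_x 5 * \sum_y \sum_z same y z * (adj G x y * adj G x z) <= _).
    by apply: ler_sum => x _; apply: sqr_sum_le_same.
  rewrite -mulr_sumr ler_pM2l // exchange_big; apply: ler_sum => y _.
  rewrite exchange_big; apply: ler_sum => z _; rewrite -mulr_sumr.
  by rewrite /common /adj; under [X in _ <= _ * X]eq_bigr do rewrite GC (GC z).
have s2 : \sum_x \sum_y twins x y * common G x y <=
    250 * n%:R ^+ 2 + 256 * #|C4_two_parts G|%:R.
  apply: le_trans (lerD (lexx _) (sum_squares_le GC G0)).
  apply: le_trans (_ : \sum_x \sum_y (10 + twins x y * squares G x y) <= _).
    apply: ler_sum => x _; apply: ler_sum => y _.
    rewrite /twins; case: (_ && _); rewrite ?mul1r ?mul0r ?addr0 ?ler0n //.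
    exact: common_le.
  under eq_bigr do rewrite big_split cst.
  by rewrite big_split cst lerD2r; lra.
(* The diagonal codegrees are degrees; half of the left-hand side of [s1] absorbs them. *)
have s3 : 5 * \sum_x common G x x <= (\sum_x deg G x ^+ 2) / 2 + 25 / 2 * (5 * n%:R).
  rewrite [25 / 2 * _]mulrC -cst mulr_sumr mulr_suml -big_split; apply: ler_sum => x _ /=.
  rewrite common_diag; have := sqr_ge0 (deg G x - 5); rewrite sqrrB; lra.
move: s1; rewrite sum_same; lra.
Qed.

End Degrees.

(** * Normalising the graph: degree cutoff and verification of the kernel hypotheses *)

Lemma avg_pair (K : realFieldType) (S T : finType) (F : S -> T -> K) :
  \E_x \E_y F x y = avg (fun p : S * T => F p.1 p.2).
Proof. by rewrite /avg -mulr_sumr pair_big mulrA -invfM -natrM -card_prod. Qed.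

Lemma ktr5E (K : realFieldType) (T : finType) (A1 A2 A3 A4 A5 : T -> T -> K) :
  ktr5 A1 A2 A3 A4 A5 = avg (fun p : T * T * T * T * T => let: (a, b, c, d, e) := p in
    A1 a b * (A2 b c * (A3 c d * (A4 d e * A5 e a)))).
Proof.
pose F a b c d e := A1 a b * (A2 b c * (A3 c d * (A4 d e * A5 e a))).
transitivity (\E_a \E_b \E_c \E_d \E_e F a b c d e); last first.
  by rewrite !avg_pair; apply: eq_avg => -[[[[a b] c] d] e].
apply: eq_avg => a; apply: eq_avg => b; rewrite -avgZl; apply: eq_avg => c.
by rewrite -!avgZl; apply: eq_avg => d; rewrite -!avgZl.
Qed.

Section Reduction.
Variables (K : archiRealFieldType) (n : nat) (G : rel (vtx n)) (s d : K).
Hypotheses (G_simple : simple_graph G) (s_gt0 : 0 < s) (d_gt0 : 0 < d) (sqr_s : s ^+ 2 = n%:R).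

Let GC : symmetric G. Proof. by case: G_simple. Qed.
Let G0 : irreflexive G. Proof. by case: G_simple => _ H x; apply: negbTE. Qed.
Let n_gt0 : 0 < n%:R :> K. Proof. by rewrite -sqr_s exprn_gt0. Qed.

(** A degree of [5 * d * s] among [5 * n] vertices, with edge weight [s] and [s ^+ 2 = n], is a
    normalised degree of [d]. *)
Definition low_degree : rel (vtx n) :=
  fun x y => [&& G x y, deg K G x <= 5 * d * s & deg K G y <= 5 * d * s].

Definition vpart (x : vtx n) : nat := part x.

Lemma low_degree_sym : symmetric low_degree.
Proof. by move=> x y; rewrite /low_degree GC [X in _ && X]andbC. Qed.

Lemma low_degree_sub : subrel low_degree G.
Proof. by move=> x y /and3P[]. Qed.

Lemma adj_sub (H1 H2 : rel (vtx n)) x y : subrel H1 H2 -> adj K H1 x y <= adj K H2 x y.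
Proof. by move=> sub; rewrite /adj ler_nat; case h: (H1 x y) => //; rewrite sub. Qed.

Lemma deg_low_degree x : deg K low_degree x <= 5 * d * s.
Proof.
case: (leP (deg K G x) (5 * d * s)) => h.
  by apply: le_trans h; apply: ler_sum => y _; apply: adj_sub low_degree_sub.
rewrite /deg big1 ?mulr_ge0 ?ltW // => y _.
by rewrite /adj /low_degree leNgt h andbF.
Qed.

Lemma common_low_degree x y : common K low_degree x y <= common K G x y.
Proof.
apply: ler_sum => z _; apply: ler_pM; rewrite ?adj_ge0 //; apply: adj_sub; exact: low_degree_sub.
Qed.

(** Markov: a deleted edge has endpoint degrees summing to more than [5 * d * s], while the sum of
    these over all ordered edges is twice the sum of squared degrees. *)
Lemma low_degree_cost :
  gap K G low_degree * (5 * d * s) <= 2 * \sum_x deg K G x ^+ 2.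
Proof.
have -> : 2 * \sum_x deg K G x ^+ 2 =
    \sum_x \sum_y (adj K G x y * deg K G x + adj K G x y * deg K G y).
  under [RHS]eq_bigr do rewrite big_split.
  rewrite big_split /= [X in _ + X]exchange_big /= mulr2n mulrDl mul1r; congr (_ + _).
    by apply: eq_bigr => x _; rewrite -mulr_suml expr2.
  by apply: eq_bigr => x _; rewrite expr2 {1}/deg mulr_suml; apply: eq_bigr => y _; rewrite /adj GC.
rewrite /gap mulr_suml; apply: ler_sum => x _; rewrite mulr_suml; apply: ler_sum => y _.
have dx := deg_ge0 K G x; have dy := deg_ge0 K G y.
have ds : 0 < 5 * d * s by rewrite !mulr_gt0.
rewrite /adj /low_degree; case: (G x y) => /=; last by rewrite !mul0r subrr mul0r addr0.
case: (leP (deg K G x) (5 * d * s)) => hx; case: (leP (deg K G y) (5 * d * s)) => hy; rewrite /= ?mulr1n ?mulr0n; lra.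
Qed.

Lemma avg2E (F : vtx n -> vtx n -> K) : \E_x \E_y F x y = (\sum_x \sum_y F x y) / (25 * n%:R ^+ 2).
Proof.
rewrite /avg -mulr_sumr card_vtx natrM mulrA mulrC; congr (_ * _).
by rewrite -invfM; congr (_^-1); ring.
Qed.

(* The vertex set has [5 * n] elements while [s ^+ 2 = n], hence the factor 5. *)
Lemma codeg_low_degree x y : codeg (rel_kernel s low_degree) x y = common K low_degree x y / 5.
Proof.
rewrite /codeg /avg card_vtx natrM mulrC.
have -> : \sum_z rel_kernel s low_degree x z * rel_kernel s low_degree y z =
    n%:R * common K low_degree x y.
  by rewrite -sqr_s mulr_sumr; apply: eq_bigr => z _; rewrite /rel_kernel /adj; ring.
by field; rewrite gt_eqF.
Qed.

Let sum_cst (c : K) : \sum_(x : vtx n) c = 5 * n%:R * c.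
Proof. by rewrite sumr_const card_vtx -[LHS]mulr_natl natrM. Qed.

Lemma vpart_eq x y : (vpart x == vpart y) = (part x == part y).
Proof. by []. Qed.

(** The diagonal contributes order [n * d * s], negligible once [d <= b * s]; off the diagonal the
    excess codegree is bounded by 4-cycles. *)
Lemma sparse_low_degree (b : K) : d <= b * s -> #|C4_two_parts G|%:R <= b / 4 * n%:R ^+ 2 ->
  sparse_kernel vpart (rel_kernel s low_degree) d b.
Proof.
move=> dbs c4.
split.
- by move=> x y; rewrite /rel_kernel low_degree_sym.
- by move=> x y; rewrite mulr_ge0 ?ler0n ?ltW.
- move=> x; rewrite /rel_kernel avgZl /avg card_vtx natrM.
  have := deg_low_degree x; rewrite /deg /adj; set S := \sum_y _ => hS.
  apply: le_trans (_ : s * ((5 * n%:R)^-1 * (5 * d * s)) <= _).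
    by rewrite ler_pM2l // ler_pM2l // invr_gt0 mulr_gt0.
  by rewrite -sqr_s le_eqVlt; apply/orP; left; apply/eqP; field; rewrite gt_eqF.
rewrite avg2E ler_pdivrMr ?mulr_gt0 ?exprn_gt0 //.
under eq_bigr => x _ do under eq_bigr => y _ do rewrite vpart_eq codeg_low_degree.
rewrite -/(same K) (sum_same (fun x y => Num.max 0 (common K low_degree x y / 5 - 2))).
have t1 : \sum_x Num.max 0 (common K low_degree x x / 5 - 2) <= 5 * n%:R * (d * s).
  rewrite -sum_cst; apply: ler_sum => x _; have := deg_low_degree x.
  by rewrite common_diag ge_max; have : 0 < d * s by [rewrite mulr_gt0]; lra.
have t2 : \sum_x \sum_y twins K x y * Num.max 0 (common K low_degree x y / 5 - 2) <=
    256 / 5 * #|C4_two_parts G|%:R.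
  rewrite mulrAC ler_pdivlMr //; apply: le_trans (sum_squares_le K GC G0).
  rewrite mulr_suml; apply: ler_sum => x _; rewrite mulr_suml; apply: ler_sum => y _.
  rewrite -mulrA ler_wpM2l ?ler0n // -ler_pdivlMr //.
  have := common_low_degree x y; have := common_le K G x y; have := squares_ge0 K G x y.
  by rewrite ge_max; lra.
have t3 : n%:R * (d * s) <= b * n%:R ^+ 2.
  have -> : b * n%:R ^+ 2 = n%:R * (b * s * s) by rewrite -sqr_s; ring.
  by rewrite ler_pM2l // ler_pM2r.
have t0 : 0 <= n%:R * (d * s) by rewrite !mulr_ge0 // ltW.
lra.
Qed.

Lemma codeg_l2_low_degree : #|C4_two_parts G|%:R <= n%:R ^+ 2 :> K ->
  \E_x \E_y ((vpart x == vpart y)%:R * codeg (rel_kernel s low_degree) x y ^+ 2) <= d ^+ 2 + 6.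
Proof.
move=> c4; rewrite avg2E ler_pdivrMr ?mulr_gt0 ?exprn_gt0 //.
under eq_bigr => x _ do under eq_bigr => y _ do rewrite vpart_eq codeg_low_degree.
rewrite -/(same K) (sum_same (fun x y => (common K low_degree x y / 5) ^+ 2)).
have t1 : \sum_x (common K low_degree x x / 5) ^+ 2 <= 5 * n%:R * (d ^+ 2 * n%:R).
  rewrite -sum_cst; apply: ler_sum => x _; rewrite -sqr_s -exprMn common_diag.
  have := deg_low_degree x; have := deg_ge0 K low_degree x => h0 h1.
  by rewrite ler_pXn2r ?nnegrE ?mulr_ge0 ?divr_ge0 ?invr_ge0 ?(ltW d_gt0) ?(ltW s_gt0) // ler_pdivrMr //; lra.
have t2 : \sum_x \sum_y twins K x y * (common K low_degree x y / 5) ^+ 2 <=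
    25 * n%:R ^+ 2 + 2 / 5 * 256 * #|C4_two_parts G|%:R.
  have sq := sum_squares_le K GC G0.
  apply: le_trans (_ : \sum_x \sum_y (1 + 2 / 5 * (twins K x y * squares K G x y)) <= _).
    apply: ler_sum => x _; apply: ler_sum => y _.
    rewrite /twins; case: (_ && _); rewrite ?mulr1n ?mulr0n ?mul1r ?mul0r ?mulr0 ?addr0 ?ler01 //.
    have c0 : 0 <= common K low_degree x y.
      by apply: sumr_ge0 => z _; rewrite mulr_ge0 ?ler0n.
    have := common_low_degree x y; have := common_sqr_le K G x y => h1 h2.
    have : common K low_degree x y ^+ 2 <= common K G x y ^+ 2.
      by rewrite ler_pXn2r ?nnegrE // (le_trans c0).
    have -> : (common K low_degree x y / 5) ^+ 2 = common K low_degree x y ^+ 2 / 25 by field.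
    lra.
  under eq_bigr do rewrite big_split sum_cst -mulr_sumr.
  rewrite big_split sum_cst -mulr_sumr /=; lra.
have : 0 <= d ^+ 2 * n%:R ^+ 2 by rewrite mulr_ge0 ?sqr_ge0.
have : 0 <= n%:R ^+ 2 :> K by rewrite sqr_ge0.
lra.
Qed.

Lemma vpart_minblock : minblock (1 / 5 : K) vpart.
Proof.
move=> x; rewrite /blockm /avg sum_indicator card_vtx natrM.
have -> : #|[set y | vpart x == vpart y]| = n.
  have -> : [set y | vpart x == vpart y] = setX [set part x] [set: 'I_n].
    by apply/setP => -[i j]; rewrite !inE vpart_eq eq_sym andbT.
  by rewrite cardsX cards1 mul1n cardsT card_ord.
by rewrite le_eqVlt; apply/orP; left; apply/eqP; field; rewrite gt_eqF.
Qed.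

(** Distinct parts force distinct vertices, so every tuple counted is a genuine 5-cycle. *)
Lemma five_cycle_density x1 x2 x3 x4 x5 : uniq [:: part x1; part x2; part x3; part x4; part x5] ->
  let sg := between vpart (rel_kernel s low_degree) in
  (ktr5 (sg x1 x2) (sg x2 x3) (sg x3 x4) (sg x4 x5) (sg x5 x1) * (n%:R ^+ 2 * s)
    <= #|copies G 5|%:R : Prop).
Proof.
move=> ux sg; rewrite ktr5E.
pose P (p : vtx n * vtx n * vtx n * vtx n * vtx n) := let: (a, b, c, d, e) := p in
  [&& uniq [:: a; b; c; d; e], G a b, G b c, G c d, G d e & G e a].
apply: le_trans (_ : s ^+ 5 * (avg (fun p => (P p)%:R)) * (n%:R ^+ 2 * s) <= _).
  rewrite ler_pM2r ?mulr_gt0 ?exprn_gt0 // -avgZl; apply: ler_avg => -[[[[a b] c] e] f].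
  have sgE x y u v : sg x y u v = s * [&& part x == part u, part y == part v & low_degree u v]%:R.
    by rewrite /sg /between /restrict /rel_kernel -!mulnb !natrM !vpart_eq; ring.
  rewrite !sgE.
  set B1 := [&& _, _ & _]; set B2 := [&& _, _ & low_degree b c].
  set B3 := [&& _, _ & low_degree c e]; set B4 := [&& _, _ & low_degree e f].
  set B5 := [&& _, _ & low_degree f a].
  have -> : s * B1%:R * (s * B2%:R * (s * B3%:R * (s * B4%:R * (s * B5%:R)))) =
     s ^+ 5 * [&& B1, B2, B3, B4 & B5]%:R by rewrite -!mulnb !natrM; ring.
  rewrite ler_wpM2l ?exprn_ge0 ?(ltW s_gt0) // ler_nat.
  case: (boolP [&& B1, B2, B3, B4 & B5]) => // /and5P[].
  move=> /and3P[/eqP e1 /eqP e2 /low_degree_sub h1] /and3P[_ /eqP e3 /low_degree_sub h2].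
  move=> /and3P[_ /eqP e4 /low_degree_sub h3] /and3P[_ /eqP e5 /low_degree_sub h4].
  move=> /and3P[_ _ /low_degree_sub h5].
  rewrite /P h1 h2 h3 h4 h5 !andbT (map_uniq (f := part)) //=.
  by rewrite -e1 -e2 -e3 -e4 -e5.
have count := five_tuple_count G; rewrite -(ler_nat K) natrM in count.
rewrite /avg sum_indicator !card_prod !card_ord.
(* Here [s ^+ 5 * n ^ 2 * s = n ^ 5]; what remains of [(5 * n) ^ 5] is [5 ^ 5 = 3125], the overcount
   in [five_tuple_count]. *)
have -> : s ^+ 5 * ((5 * n * (5 * n) * (5 * n) * (5 * n) * (5 * n))%:R^-1 * #|[set p | P p]|%:R) *
   (n%:R ^+ 2 * s) = #|[set p | P p]|%:R / 3125.
  rewrite !natrM -sqr_s; field; rewrite gt_eqF //.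
rewrite ler_pdivrMr // mulrC; exact: count.
Qed.

Lemma edges_diff_le (H : rel (vtx n)) : subrel H G ->
  #|edges G :\: edges H|%:R <= gap K G H.
Proof.
move=> HG; pose D (p : vtx n * vtx n) := G p.1 p.2 && ~~ H p.1 p.2.
have -> : gap K G H = #|[set p | D p]|%:R.
  rewrite /gap -sum_indicator pair_big; apply: eq_bigr => -[x y] _; rewrite /adj /D /=.
  case h: (H x y); first by rewrite HG // subrr.
  by rewrite subr0 andbT.
rewrite ler_nat; apply: leq_trans (leq_imset_card (fun p : vtx n * vtx n => [set p.1; p.2]) _).
apply: subset_leq_card; apply/subsetP => e /setDP[/imset2P[x y _] ].
rewrite inE => /andP[_ xy] -> eH; apply/imsetP; exists (x, y) => //.
rewrite inE /D xy /=; apply: contra eH => Hxy.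
by apply/imset2P; exists x y; rewrite ?inE.
Qed.

End Reduction.

(** * Choice of constants and the removal statement over a general real field *)

Theorem five_partite_removal (K : archiRealFieldType) (eps : K) : 0 < eps ->
  exists delta : K, 0 < delta /\ forall (n : nat) (G : rel (vtx n)) (s : K),
    simple_graph G -> cyclic_5partite G -> 0 <= s -> s ^+ 2 = n%:R ->
    #|C4_two_parts G|%:R <= delta * n%:R ^+ 2 ->
    #|copies G 5|%:R <= delta * (n%:R ^+ 2 * s) ->
    exists H : rel (vtx n), [/\ simple_graph H, subrel H G,
      #|edges G :\: edges H|%:R <= eps * (n%:R * s) & Ck_free H 5].
Proof.
(* For [n >= 1] and at most [n ^ 2] relevant copies of C4, twice the sum of squared degrees is below
   [12500 * n ^ 2], and [12500 = eps / 2 * 5 * d]: the cutoff costs at most half of the budget. *)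
move=> eps0; pose d := 5000 / eps; have d0 : 0 < d by rewrite divr_gt0.
have C0 : 0 < d ^+ 2 + 6 by rewrite addr_gt0 // exprn_gt0.
have k0 : 0 < 1 / 5 :> K by lra.
(* Averages run over [25 * n ^ 2] pairs, so [eps / 50] becomes the other half of the budget. *)
have e0 : 0 < eps / 50 by rewrite divr_gt0.
have [b [gam [b0 gam0 core]]] := sparse_five_cycle_removal d0 C0 k0 e0.
have db0 : 0 < d / b by rewrite divr_gt0.
(* This settles small [n]: if [s < d / b], then [n ^ 2 * s = s ^ 5] and fewer than one copy of C5
   exists, so nothing is removed. *)
pose q := ((d / b) ^+ 5)^-1; have q0 : 0 < q by rewrite invr_gt0 exprn_gt0.
pose delta := Num.min (Num.min 1 (b / 4)) (Num.min (gam / 2) q).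
have delta0 : 0 < delta by rewrite !lt_min ltr01 q0 !divr_gt0.
have [de1 deb deg_am deq] : [/\ delta <= 1, delta <= b / 4, delta <= gam / 2 & delta <= q].
  by rewrite /delta !ge_min !lexx ?orbT.
exists delta; split=> // n G s Gs Gcyc s0 sn c4 c5.
have n0 : 0 <= n%:R :> K := ler0n _ _.
have [small|large] := ltP (b * s) d.
  exists G; split=> //; first by rewrite setDv cards0 mulr_ge0 ?mulr_ge0 // ltW.
  apply/eqP; rewrite -cards_eq0 -leqn0 -ltnS -(ltr_nat K); apply: le_lt_trans c5 _.
  have sdb : s < d / b by rewrite ltr_pdivlMr // mulrC.
  have -> : n%:R ^+ 2 * s = s ^+ 5 by rewrite -sn; ring.
  have [->|sN0] := eqVneq s 0; first by rewrite expr0n mulr0 ltr01.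
  apply: le_lt_trans (_ : q * s ^+ 5 < 1); first by rewrite ler_wpM2r ?exprn_ge0.
  by rewrite mulrC ltr_pdivrMr ?exprn_gt0 // mul1r ltrXn2r // ltW.
have s_gt0 : 0 < s.
  by rewrite -(pmulr_rgt0 _ b0); apply: lt_le_trans large.
have n_gt0 : 0 < n%:R :> K by rewrite -sn exprn_gt0.
have [GC G0] := Gs.
pose L := low_degree G s d.
have c4b : #|C4_two_parts G|%:R <= b / 4 * n%:R ^+ 2.
  by apply: le_trans c4 _; rewrite ler_wpM2r ?sqr_ge0.
have c41 : #|C4_two_parts G|%:R <= n%:R ^+ 2 :> K.
  by apply: le_trans c4 _; rewrite ler_piMl ?sqr_ge0.
have [H [HC HL Hcost Hcyc]] := core _ _ L s s0 (low_degree_sym s d Gs) (vpart_minblock s_gt0 sn)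
  (sparse_low_degree Gs s_gt0 d0 sn large c4b) (codeg_l2_low_degree Gs s_gt0 d0 sn c41).
have HG : subrel H G by move=> x y /HL /low_degree_sub.
exists H; split=> //.
- by split=> [x y|x]; [exact: HC | apply: contraNN (G0 x) => /HG].
- have cost1 := low_degree_cost Gs s_gt0 d0.
  have S := sum_deg_sqr_le K (GC : symmetric G) (fun x => negbTE (G0 x)).
  move: Hcost; rewrite avg2E // ler_pdivrMr ?mulr_gt0 ?exprn_gt0 // => cost2.
  have cost2' : gap K L H <= eps / 2 * (n%:R * s).
    rewrite -(ler_pM2l s_gt0) /gap mulr_sumr.
    apply: le_trans (_ : \sum_x \sum_y (rel_kernel s L x y - rel_kernel s H x y) <= _).
      by apply: ler_sum => x _; rewrite mulr_sumr; apply: ler_sum => y _; rewrite mulrBr.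
    by apply: le_trans cost2 _; rewrite -sn le_eqVlt; apply/orP; left; apply/eqP; field.
  have n1 : 1 <= n%:R :> K by rewrite ler1n -(ltr0n K).
  have cost1' : gap K G L <= eps / 2 * (n%:R * s).
    have ds : 0 < 5 * d * s by rewrite mulr_gt0 // mulr_gt0.
    rewrite -(ler_pM2r ds); apply: le_trans cost1 _.
    have -> : eps / 2 * (n%:R * s) * (5 * d * s) = 12500 * n%:R ^+ 2.
      by rewrite /d -sn; field; rewrite gt_eqF.
    have : n%:R <= n%:R ^+ 2 :> K by rewrite expr2 ler_peMl.
    lra.
  apply: le_trans (edges_diff_le K HG) _; rewrite (gap_split K G L H); lra.
apply/eqP; rewrite -cards_eq0 -leqn0 leqNgt; apply/negP => /card_gt0P[E].
rewrite inE => /existsP[f /and4P[_ _ /forallP fH _]].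
have h (i j : 'I_5) : ordS i = j -> H (f i) (f j) by move=> <-; apply: fH.
pose i0 : 'I_5 := @Ordinal 5 0 isT; pose i1 : 'I_5 := @Ordinal 5 1 isT.
pose i2 : 'I_5 := @Ordinal 5 2 isT; pose i3 : 'I_5 := @Ordinal 5 3 isT.
pose i4 : 'I_5 := @Ordinal 5 4 isT.
have h0 : H (f i0) (f i1) by apply: h; apply: val_inj.
have h1 : H (f i1) (f i2) by apply: h; apply: val_inj.
have h2 : H (f i2) (f i3) by apply: h; apply: val_inj.
have h3 : H (f i3) (f i4) by apply: h; apply: val_inj.
have h4 : H (f i4) (f i0) by apply: h; apply: val_inj.
(* A surviving 5-cycle projects to a closed walk of length five on the cyclic arrangement of parts,
   hence meets each part once. *)
have upart : uniq [:: part (f i0); part (f i1); part (f i2); part (f i3); part (f i4)].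
  apply: cyclic_walk_uniq => //=.
  by rewrite !(Gcyc _ _ (HG _ _ _)).
have := Hcyc _ _ _ _ _ (And5 h0 h1 h2 h3 h4).
move=> /=; set c := ktr5 _ _ _ _ _ => gam_c.
have cle : c * (n%:R ^+ 2 * s) <= #|copies G 5|%:R by exact: five_cycle_density.
have ns0 : 0 < n%:R ^+ 2 * s by rewrite mulr_gt0 // exprn_gt0.
have := le_trans cle c5; rewrite ler_pM2r //; lra.
Qed.

(** * Transfer to the Stdlib real numbers *)

Lemma sqrt_nat_ge0 (n : nat) : 0 <= sqrt n%:R.
Proof. by apply/RleP; exact: sqrt_pos. Qed.

Lemma sqr_sqrt_nat (n : nat) : sqrt n%:R ^+ 2 = n%:R.
Proof. by rewrite RsqrtE sqr_sqrtr. Qed.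

Local Close Scope ring_scope.
Delimit Scope R_scope with R.

Theorem theorem1p7 :
  forall eps : R, (0 < eps)%R ->
  exists delta : R, (0 < delta)%R /\
  forall (n : nat) (G : rel (vtx n)),
    simple_graph G ->
    cyclic_5partite G ->
    (INR #|C4_two_parts G| <= delta * INR n ^ 2)%R ->
    (INR #|copies G 5| <= delta * (INR n ^ 2 * sqrt (INR n)))%R ->
    exists H : rel (vtx n),
      simple_graph H /\
      (forall x y, H x y -> G x y) /\
      (INR #|edges G :\: edges H| <= eps * (INR n * sqrt (INR n)))%R /\
      Ck_free H 5.
Proof.
move=> eps /RltP eps0; have [delta [delta0 removal]] := five_partite_removal eps0.
exists delta; split; first exact/RltP.
move=> n G G_simple G_cyclic /RleP C4_few /RleP C5_few.
rewrite !RmultE RpowE !INRE in C4_few C5_few.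
have s0 := sqrt_nat_ge0 n; have sqr_s := sqr_sqrt_nat n.
have [H [H_simple HG cost H_free]] := removal n G _ G_simple G_cyclic s0 sqr_s C4_few C5_few.
exists H; split=> //; split=> //; split=> //.
by apply/RleP; rewrite !RmultE !INRE.
Qed.
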